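(* Let $R$ be an arbitrary associative unital ring. The class $\mathcal{FM}$ of all flat Mittag-Leffler right $R$-modules is precovering if and only if $R$ is right perfect.
   Context: Modules are right $R$-modules unless stated otherwise. A right $R$-module $M$ is flat Mittag-Leffler if the functor $M\otimes_R-$ from left $R$-modules to abelian groups is exact, and for each family $(Q_i\mid i\in I)$ of left $R$-modules the canonical group homomorphism $\varphi: M\otimes_R\prod_{i\in I}Q_i\to\prod_{i\in I}M\otimes_R Q_i$, $\varphi(m\otimes_R(q_i)_{i\in I})=(m\otimes_R q_i)_{i\in I}$, is monic. A class $\mathcal C$ of modules is precovering if for each module $M$ there exists a homomorphism $f\in\operatorname{Hom}_R(C,M)$ with $C\in\mathcal C$ such that each homomorphism $f'\in\operatorname{Hom}_R(C',M)$ with $C'\in\mathcal C$ factors through $f$ (i.e. $f'=fg$ for some $g\in\operatorname{Hom}_R(C',C)$). *)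

(* Defs.v *)
From HB Require Import structures.
From mathcomp Require Import all_boot all_algebra.
From mathcomp Require Import ring_quotient.
From mathcomp Require Import boolp.
From mathcomp.multinomials Require Import freeg.

Set Implicit Arguments.
Unset Strict Implicit.
Unset Printing Implicit Defensive.

Import GRing.Theory.
Local Open Scope ring_scope.
Local Open Scope quotient_scope.

(* A right R-module is a left module over the converse ring R^c: for          *)
(* m : rmodType R and r : R^c, the term r *: m is the right action m r.       *)
(* R is a pzRingType, so the zero ring is allowed.                            *)
Notation rmodType R := (lmodType (GRing.converse R)).

Section DirectProduct.
Variable I : Type.

Definition dprod (V : I -> Type) : Type := forall i, V i.

Section Zmod.
Variable V : I -> zmodType.
Implicit Types f g h : dprod V.

HB.instance Definition _ := gen_eqMixin (dprod V).
HB.instance Definition _ := gen_choiceMixin (dprod V).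

Definition dprod_zero : dprod V := fun=> 0.
Definition dprod_opp f : dprod V := fun i => - f i.
Definition dprod_add f g : dprod V := fun i => f i + g i.

Fact dprod_addA : associative dprod_add.
Proof. by move=> f g h; apply: functional_extensionality_dep => i; exact: addrA. Qed.
Fact dprod_addC : commutative dprod_add.
Proof. by move=> f g; apply: functional_extensionality_dep => i; exact: addrC. Qed.
Fact dprod_add0 : left_id dprod_zero dprod_add.
Proof. by move=> f; apply: functional_extensionality_dep => i; exact: add0r. Qed.
Fact dprod_addN : left_inverse dprod_zero dprod_opp dprod_add.
Proof. by move=> f; apply: functional_extensionality_dep => i; exact: addNr. Qed.

HB.instance Definition _ := GRing.isZmodule.Build (dprod V)
  dprod_addA dprod_addC dprod_add0 dprod_addN.
End Zmod.

Section Lmod.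
Variables (R : pzRingType) (V : I -> lmodType R).
Implicit Types f g : dprod V.

Definition dprod_scale (a : R) f : dprod V := fun i => a *: f i.

Fact dprod_scaleA a b f :
  dprod_scale a (dprod_scale b f) = dprod_scale (a * b) f.
Proof. by apply: functional_extensionality_dep => i; exact: scalerA. Qed.
Fact dprod_scale1 : left_id 1 dprod_scale.
Proof. by move=> f; apply: functional_extensionality_dep => i; exact: scale1r. Qed.
Fact dprod_scaleDr : right_distributive dprod_scale +%R.
Proof. by move=> a f g; apply: functional_extensionality_dep => i; exact: scalerDr. Qed.
Fact dprod_scaleDl f : {morph dprod_scale^~ f : a b / a + b}.
Proof. by move=> a b; apply: functional_extensionality_dep => i; exact: scalerDl. Qed.

HB.instance Definition _ := GRing.Zmodule_isLmodule.Build R (dprod V)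
  dprod_scaleA dprod_scale1 dprod_scaleDr dprod_scaleDl.
End Lmod.
End DirectProduct.

Section Tensor.
Variables (R : pzRingType) (M : rmodType R) (N : lmodType R).

Inductive tensor_relation : {freeg (M * N) / int} -> Prop :=
| TensorAddl m m' n :
    tensor_relation (<< (m + m', n) >> - << (m, n) >> - << (m', n) >>)
| TensorAddr m n n' :
    tensor_relation (<< (m, n + n') >> - << (m, n) >> - << (m, n') >>)
| TensorBal m (r : R) n :
    tensor_relation (<< ((r : R^c) *: m, n) >> - << (m, r *: n) >>).

Definition tensor_null : {pred {freeg (M * N) / int}} :=
  fun x => `[< forall S : {pred {freeg (M * N) / int}}, zmod_closed S ->
                 (forall y, tensor_relation y -> y \in S) -> x \in S >].

Fact tensor_null_closed : zmod_closed tensor_null.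
Proof.
split; first by apply/asboolP => S [].
move=> x y /asboolP xP /asboolP yP; apply/asboolP => S cS rS.
by case: (cS) => _; apply; [exact: xP | exact: yP].
Qed.

HB.instance Definition _ :=
  GRing.isZmodClosed.Build _ tensor_null tensor_null_closed.

Definition tensor : Type := Quotient.quot tensor_null.
HB.instance Definition _ := GRing.Zmodule.on tensor.

Definition tens (m : M) (n : N) : tensor :=
  \pi_(Quotient.quot tensor_null) << (m, n) >>.

Definition balanced (G : zmodType) (b : M -> N -> G) : Prop :=
  [/\ forall m m' n, b (m + m') n = b m n + b m' n,
      forall m n n', b m (n + n') = b m n + b m n'
    & forall m (r : R) n, b ((r : R^c) *: m) n = b m (r *: n)].

(* Only meaningful for balanced b: see tensor_lift_additive, tensor_lift_tens *)
(* and tensor_lift_unique below.                                              *)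
Definition tensor_lift (G : zmodType) (b : M -> N -> G) (t : tensor) : G :=
  fglift (fun p : M * N => b p.1 p.2 : zmodule G) (repr t).

Lemma tens_balanced : balanced tens.
Proof.
have rel (x y : {freeg (M * N) / int}) : tensor_relation (x - y) ->
    \pi_(Quotient.quot tensor_null) x = \pi_(Quotient.quot tensor_null) y.
  move=> rxy; apply/eqP; rewrite eqmodE; apply/asboolP => S _; exact.
split=> [m m' n|m n n'|m r n]; rewrite /tens.
- rewrite -[LHS]/(_ : Quotient.quot _) -[RHS]/(_ + _ : Quotient.quot _) -raddfD.
  by apply: rel; rewrite opprD addrA; exact: TensorAddl.
- rewrite -[LHS]/(_ : Quotient.quot _) -[RHS]/(_ + _ : Quotient.quot _) -raddfD.
  by apply: rel; rewrite opprD addrA; exact: TensorAddr.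
- by apply: rel; exact: TensorBal.
Qed.

Section Lift.
Variables (G : zmodType) (b : M -> N -> G).
Hypothesis b_bal : balanced b.
Local Notation L := (fglift (fun p : M * N => b p.1 p.2 : zmodule G)).

Lemma fglift_tensor_null x : x \in tensor_null -> L x = 0.
Proof.
have LB y z : L (y - z) = L y - L z by exact: lift_is_additive.
have LU p : L << p >> = b p.1 p.2 by rewrite liftU scale1r.
move=> /asboolP /(_ [pred y | L y == 0]) xP; apply/eqP; apply: xP.
  split=> [|y z]; rewrite !inE.
    by rewrite -[0](subrr (0 : {freeg (M * N) / int})) LB subrr.
  by rewrite LB => /eqP-> /eqP->; rewrite subrr.
case: b_bal => bDl bDr bZ.
move=> _ [m m' n|m n n'|m r n]; rewrite inE !LB !LU /=; apply/eqP.
- by rewrite bDl addrAC addrK subrr.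
- by rewrite bDr addrAC addrK subrr.
- by rewrite bZ subrr.
Qed.

Lemma tensor_lift_pi x :
  tensor_lift b (\pi_(Quotient.quot tensor_null) x) = L x.
Proof.
apply/eqP; rewrite -subr_eq0 /tensor_lift.
rewrite -[_ - _](lift_is_additive (R := int) (M := zmodule G)).
apply/eqP/fglift_tensor_null.
by rewrite Quotient.idealrBE reprK.
Qed.

Lemma tensor_lift_tens m n : tensor_lift b (tens m n) = b m n.
Proof. by rewrite tensor_lift_pi liftU scale1r. Qed.

Lemma tensor_lift_additive : zmod_morphism (tensor_lift b).
Proof.
elim/quotW=> x; elim/quotW=> y.
have <- : \pi_(Quotient.quot tensor_null) (x - y) = \pi x - \pi y :> tensor.
  exact: raddfB.
by rewrite !tensor_lift_pi (lift_is_additive (R := int) (M := zmodule G)).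
Qed.

Lemma tensor_lift_unique (h : {additive tensor -> G}) :
  (forall m n, h (tens m n) = b m n) -> h =1 tensor_lift b.
Proof.
move=> hb; elim/quotW=> x; rewrite tensor_lift_pi.
pose P (y : {freeg (M * N) / int}) := h (\pi_(Quotient.quot tensor_null) y) = L y.
have piB y z : \pi_(Quotient.quot tensor_null) (y - z) = \pi y - \pi z :> tensor.
  exact: raddfB.
have PB y z : P y -> P z -> P (y - z).
  rewrite /P piB raddfB => -> ->.
  by rewrite [RHS](lift_is_additive (R := int) (M := zmodule G)).
have P0 : P 0.
  rewrite /P -[0 in LHS](subrr (0 : {freeg (M * N) / int})) piB subrr raddf0.
  rewrite -[0 in RHS](subrr (0 : {freeg (M * N) / int})).
  by rewrite [RHS](lift_is_additive (R := int) (M := zmodule G)) subrr.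
have PN y : P y -> P (- y) by move=> Py; rewrite -sub0r; exact: PB.
have PD y z : P y -> P z -> P (y + z).
  by move=> Py Pz; rewrite -[z]opprK; apply: PB => //; exact: PN.
have P1 p : P << p >>.
  by case: p => m n; rewrite /P -[LHS]/(h (tens m n)) hb liftU scale1r.
have PU k p : P << k *g p >>.
  have PUn n : P (<< p >> *+ n).
    by elim: n => [|n IHn]; rewrite ?mulr0n // mulrS; exact: PD.
  rewrite -[k]intz -freegU_mulz; case: k => n; first exact: PUn.
  by rewrite NegzE mulrNz; exact/PN/PUn.
rewrite -[x]freeg_sumE -/(P _).
by apply: (big_ind P) => // p _; exact: PU.
Qed.
End Lift.
End Tensor.

Arguments tens {R M N}.
Arguments tensor_lift {R M N G}.

Definition tensor_map (R : pzRingType) (M : rmodType R) (A B : lmodType R)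
    (f : A -> B) : tensor M A -> tensor M B :=
  tensor_lift (fun m a => tens m (f a)).

Definition tensor_prod (R : pzRingType) (M : rmodType R) (I : Type)
    (Q : I -> lmodType R) :
    tensor M (dprod Q) -> dprod (fun i => tensor M (Q i)) :=
  tensor_lift
    (fun (m : M) (q : dprod Q) =>
       (fun i => tens m (q i)) : dprod (fun i => tensor M (Q i))).

Section TensorMaps.
Variables (R : pzRingType) (M : rmodType R).

Lemma tensor_map_balanced (A B : lmodType R) (f : {linear A -> B}) :
  balanced (fun (m : M) a => tens m (f a)).
Proof.
have [tDl tDr tZ] := tens_balanced M B.
by split=> *; rewrite ?raddfD ?linearZ /= ?tDl ?tDr ?tZ.
Qed.

Lemma tensor_map_tens (A B : lmodType R) (f : {linear A -> B}) (m : M) a :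
  tensor_map f (tens m a) = tens m (f a).
Proof. by rewrite /tensor_map (tensor_lift_tens (tensor_map_balanced f)). Qed.

Lemma tensor_map_additive (A B : lmodType R) (f : {linear A -> B}) :
  zmod_morphism (tensor_map f : tensor M A -> tensor M B).
Proof. exact: tensor_lift_additive (tensor_map_balanced f). Qed.

Lemma tensor_prod_balanced (I : Type) (Q : I -> lmodType R) :
  balanced (fun (m : M) (q : dprod Q) =>
    (fun i => tens m (q i)) : dprod (fun i => tensor M (Q i))).
Proof.
split=> *; apply: functional_extensionality_dep => i;
  by have [tDl tDr tZ] := tens_balanced M (Q i); rewrite ?tDl ?tDr ?tZ.
Qed.

Lemma tensor_prod_tens (I : Type) (Q : I -> lmodType R) (m : M) (q : dprod Q) :
  tensor_prod (tens m q) = fun i => tens m (q i).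
Proof. by rewrite /tensor_prod (tensor_lift_tens (@tensor_prod_balanced I Q)). Qed.

Lemma tensor_prod_additive (I : Type) (Q : I -> lmodType R) :
  zmod_morphism (@tensor_prod R M I Q).
Proof. exact: tensor_lift_additive (@tensor_prod_balanced I Q). Qed.
End TensorMaps.

Definition surj (A B : Type) (f : A -> B) : Prop := forall b, exists a, f a = b.

Definition short_exact (A B C : zmodType) (f : A -> B) (g : B -> C) : Prop :=
  [/\ injective f, forall b, g b = 0 <-> exists a, f a = b & surj g].

Definition flat (R : pzRingType) (M : rmodType R) : Prop :=
  forall (A B C : lmodType R) (f : {linear A -> B}) (g : {linear B -> C}),
    short_exact f g ->
    short_exact (tensor_map f : tensor M A -> tensor M B)
                (tensor_map g : tensor M B -> tensor M C).

Definition flat_mittag_leffler (R : pzRingType) (M : rmodType R) : Prop :=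
  flat M /\
  forall (I : Type) (Q : I -> lmodType R), injective (@tensor_prod R M I Q).

(* This instance makes the universe of the index types in flat_mittag_leffler *)
(* at least that of the carriers of modules.                                  *)
Lemma flat_mittag_leffler_module_index (R : pzRingType) (M : rmodType R) :
  flat_mittag_leffler M ->
  forall N Q : lmodType R, injective (@tensor_prod R M N (fun=> Q)).
Proof. by move=> [_ MML] N Q; exact: MML. Qed.

Definition precovering (R : pzRingType) (C : rmodType R -> Prop) : Prop :=
  forall M : rmodType R, exists (D : rmodType R) (f : {linear D -> M}),
    C D /\ forall (D' : rmodType R) (f' : {linear D' -> M}), C D' ->
      exists g : {linear D' -> D}, f' =1 f \o g.

Definition projective (R : pzRingType) (P : rmodType R) : Prop :=
  forall (A B : rmodType R) (g : {linear A -> B}) (h : {linear P -> B}),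
    surj g -> exists k : {linear P -> A}, h =1 g \o k.

Definition superfluous (R : pzRingType) (P : rmodType R) (K : P -> Prop) : Prop :=
  forall S : {pred P}, submod_closed S ->
    (forall x, exists s k, [/\ s \in S, K k & x = s + k]) -> forall x, x \in S.

Definition projective_cover (R : pzRingType) (P M : rmodType R)
    (p : {linear P -> M}) : Prop :=
  [/\ projective P, surj p & superfluous (fun x => p x = 0)].

(* Bass's definition of a right perfect ring. *)
Definition right_perfect (R : pzRingType) : Prop :=
  forall M : rmodType R, exists (P : rmodType R) (p : {linear P -> M}),
    projective_cover p.

(* Main.v *)
From HB Require Import structures.
From Stdlib Require Eqdep_dec.
Require Import Defs.
From mathcomp Require Import all_boot all_algebra.
From mathcomp Require Import ring_quotient boolp classical_sets fsbigop.

Set Implicit Arguments.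
Unset Strict Implicit.
Unset Printing Implicit Defensive.

Import GRing.Theory.
Local Open Scope ring_scope.
Local Open Scope quotient_scope.
Local Open Scope classical_set_scope.

(** If [R] is right perfect, every flat right module [M] is projective.  Let
    [p : P -> M] be a projective cover and [x] an element of [ker p].  Flatness
    of [M] turns a dual basis expansion of [x] into a finite rank map
    [theta : P -> ker p] with [theta x = x].  Since [ker p] is superfluous,
    [1 - theta] is onto; it splits, and its kernel, being both a direct summand
    and a part of [ker p], is zero.  Hence [x = 0].  So the flat Mittag-Leffler
    modules are the projective ones, and the free module on the elements of a
    module is a precover of it ([right_perfect_precovering]).

    Suppose conversely that flat Mittag-Leffler modules form a precovering
    class, and let [a_0, a_1, ...] be elements of [R].  The main point is that
    the chain of left ideals [R >= R a_0 >= R a_1 a_0 >= ...] is stationary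
    ([precovering_chain_stabilizes]).  Let [W] be the right module of sequences
    in [R] modulo the eventually zero ones, let [nu_n] in [W] be the class of
    [0, ..., 0, 1, a_n, a_(n+1) a_n, ...], and let [f : B -> W] be a precover.
    If [B] contains elements [s_n] with [s_n = s_(n+1) a_n] and
    [f s_n = nu_n], the Mittag-Leffler property of [B] for the left modules
    [R / R a_(k-1) ... a_0] makes the chain stationary
    ([mittag_leffler_chain]).

    The [s_n] come from a diagonal argument.  Take the tree in which a vertex
    of height [n + 1] is a vertex of height [n] together with a function from
    the vertices of height [n] to [B].  A branch of this tree is the same thing
    as a map from the set [T] of all vertices to [B], that is, a linear map to
    [B] from the free module [D] on [T].  The tree module [L], a submodule of
    [R ^ T], is generated by [D] and by elements [y_(x,n)], for [x] a branch,
    subject to [y_(x,n) = e_(x|n) + y_(x,n+1) a_n].  It is locally projective,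
    hence flat Mittag-Leffler, and for every set [S] of branches there is a map
    [g : L -> W] that kills [D], sends [y_(x,n)] to [nu_n] for [x] in [S] and
    to [0] otherwise.  Lift [g] to [h : L -> B].  The restriction of [h] to [D]
    is a branch [x].  Let [S] consist of the branches which, as maps [D -> B],
    can be extended to all [y_(x,n)] with values in [ker f].  If [x] were not
    in [S], [h] would provide such an extension; so [x] is in [S], and the
    difference of [h] and such an extension yields the [s_n].

    The chain condition produces projective covers by the argument of Bass: the
    Jacobson radical [J] is T-nilpotent, so that [M J] is superfluous in every
    [M], and [1] is a finite sum of local idempotents.  A maximal family of
    elements [m = m e], with [e] a local idempotent, that is independent modulo
    [M J] gives a projective cover of [M] by a direct sum of modules [e R]
    ([chain_condition_projective_cover]). *)

(** * Additive maps and finite sums *)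

Section ZmodMorphism.
Variables (G H : zmodType) (f : G -> H).
Hypothesis fB : zmod_morphism f.

Lemma zmod_morphism0 : f 0 = 0.
Proof. by rewrite -(subrr 0) fB subrr. Qed.

Lemma zmod_morphism_sum (J : Type) (s : seq J) (F : J -> G) :
  f (\sum_(j <- s) F j) = \sum_(j <- s) f (F j).
Proof.
pose cf := GRing.isZmodMorphism.Build G H f fB.
pose fA : {additive G -> H} := HB.pack f cf.
exact: (raddf_sum fA).
Qed.

Lemma zmod_morphism_inj : (forall x, f x = 0 -> x = 0) -> injective f.
Proof.
move=> h0 x y e; apply/eqP; rewrite -subr_eq0; apply/eqP/h0.
by rewrite fB e subrr.
Qed.
End ZmodMorphism.

Section FiniteSum.
Variables (I : Type) (G : zmodType).
Implicit Types f g : I -> G.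

Definition finsupp f : Prop :=
  exists s : seq {classic I}, forall i : {classic I}, f i <> 0 -> i \in s.

(** By convention [0] when the support of [f] is infinite. *)
Definition fsum f : G := \sum_(i \in [set: {classic I}]) f i.

Lemma fsumE f (s : seq {classic I}) :
  uniq s -> (forall i : {classic I}, f i <> 0 -> i \in s) -> fsum f = \sum_(i <- s) f i.
Proof.
move=> us sf; rewrite /fsum (@bigfs _ _ _ _ s predT f us).
  by congr bigop; congr finite_support; apply/seteqP; split.
by move=> i _ /negP si; apply: contrapT => /sf.
Qed.

Lemma finsuppP f : finsupp f ->
  exists s : seq {classic I}, uniq s /\ forall i : {classic I}, f i <> 0 -> i \in s.
Proof.
move=> [s sP]; exists (undup s); split; first exact: undup_uniq.
by move=> i /sP; rewrite mem_undup.
Qed.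

Lemma fsumD f g : finsupp f -> finsupp g ->
  fsum (fun i => f i + g i) = fsum f + fsum g.
Proof.
move=> [s sP] [t tP]; have ust := undup_uniq (s ++ t).
have mst (i : {classic I}) : f i <> 0 \/ g i <> 0 -> i \in undup (s ++ t).
  by rewrite mem_undup mem_cat => -[/sP|/tP] ->; rewrite ?orbT.
rewrite !(fsumE ust) ?big_split//.
- by move=> i gi; apply: mst; right.
- by move=> i fi; apply: mst; left.
move=> i fg; apply: mst; have [fi|] := pselect (f i = 0); last by left.
by right => gi; apply: fg; rewrite fi gi addr0.
Qed.

Lemma fsum_eq1 f (i : I) : (forall j, j <> i -> f j = 0) -> fsum f = f i.
Proof.
move=> fi; rewrite (@fsumE _ [:: (i : {classic I})])// ?big_seq1// => j fj.
by rewrite inE; apply/eqP; apply: contrapT => /fi.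
Qed.

End FiniteSum.

Lemma fsum_morph (I : Type) (G H : zmodType) (h : {additive G -> H}) (f : I -> G) :
  finsupp f -> h (fsum f) = fsum (fun i => h (f i)).
Proof.
move=> /finsuppP[s [us sP]]; rewrite (fsumE us sP) (fsumE us) ?raddf_sum// => i hf.
by apply: sP => fi; apply: hf; rewrite fi raddf0.
Qed.

Section FreeLinear.
Variables (R : pzRingType) (I : Type) (V : lmodType R) (v : I -> V).
Implicit Types f g : I -> R.

Lemma finsupp_scale f : finsupp f -> finsupp (fun i => f i *: v i).
Proof.
by move=> [s sP]; exists s => i fv; apply: sP => fi; apply: fv; rewrite fi scale0r.
Qed.

Lemma fsum_linear a f g : finsupp f -> finsupp g ->
  fsum (fun i => (a * f i + g i) *: v i) =
  a *: fsum (fun i => f i *: v i) + fsum (fun i => g i *: v i).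
Proof.
move=> ff fg; rewrite -[a *: _]/(GRing.scale a _).
rewrite (fsum_morph _ (finsupp_scale ff)) -fsumD; last first.
- exact: finsupp_scale.
- case: (finsupp_scale ff) => s sP; exists s => i fi; apply: sP => e.
  by apply: fi; rewrite /= e scaler0.
by congr fsum; apply: funext => i; rewrite scalerDl -scalerA.
Qed.
End FreeLinear.

(** * Submodules and quotients *)

Section Submodule.
Variables (R : pzRingType) (V : lmodType R) (S : {pred V}).
Hypothesis clS : submod_closed S.

Let S_isSubmodClosed := GRing.isSubmodClosed.Build R V S clS.
HB.instance Definition _ := S_isSubmodClosed.

(** The proof of closure is an argument of the type, so that its module structure
    can be inferred from the type alone. *)
Definition submodule of submod_closed S : Type := {x : V | x \in S}.
Local Notation sub := (submodule clS).
HB.instance Definition _ := [isSub of sub for @sval V (fun x => x \in S)].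
HB.instance Definition _ := [Choice of sub by <:].
HB.instance Definition _ := [SubChoice_isSubLmodule of sub by <:].

Definition submod_val (x : sub) : V := \val x.
Fact submod_val_linear : linear submod_val.
Proof. by []. Qed.
HB.instance Definition _ := GRing.isLinear.Build R sub V *:%R submod_val submod_val_linear.

Definition submod_mk (x : V) (xS : x \in S) : sub := exist _ x xS.
Lemma submod_valP (x : sub) : submod_val x \in S.
Proof. exact: valP. Qed.
Lemma submod_val_inj : injective submod_val.
Proof. exact: val_inj. Qed.

End Submodule.

Section QuotientModule.
Variables (R : pzRingType) (V : lmodType R) (S : {pred V}).
Hypothesis clS : submod_closed S.

Let S_isSubmodClosed := GRing.isSubmodClosed.Build R V S clS.
HB.instance Definition _ := S_isSubmodClosed.

Definition quotmod : Type := Quotient.quot S.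
Local Notation Q := quotmod.
HB.instance Definition _ := GRing.Zmodule.on Q.

Definition quotmod_pi (x : V) : Q := \pi_(Quotient.quot S) x.

Lemma quotmod_eq x y : quotmod_pi x = quotmod_pi y <-> x - y \in S.
Proof.
rewrite Quotient.idealrBE; split=> [xy|/eqP//]; exact/eqP.
Qed.

Lemma quotmod_surj : surj quotmod_pi.
Proof. by move=> q; exists (repr (q : Quotient.quot S)); rewrite /quotmod_pi reprK. Qed.

Definition quotmod_scale (r : R) (q : Q) : Q :=
  quotmod_pi (r *: repr (q : Quotient.quot S)).

Lemma quotmod_scale_pi r x : quotmod_scale r (quotmod_pi x) = quotmod_pi (r *: x).
Proof.
apply/quotmod_eq; rewrite -scalerBr; apply: rpredZ.
by apply/quotmod_eq; rewrite /quotmod_pi reprK.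
Qed.

Lemma quotmod_piD x y : quotmod_pi (x + y) = quotmod_pi x + quotmod_pi y.
Proof. exact: raddfD. Qed.

Fact quotmod_scaleA a b q :
  quotmod_scale a (quotmod_scale b q) = quotmod_scale (a * b) q.
Proof. by have [x <-] := quotmod_surj q; rewrite !quotmod_scale_pi scalerA. Qed.
Fact quotmod_scale1 : left_id 1 quotmod_scale.
Proof. by move=> q; have [x <-] := quotmod_surj q; rewrite quotmod_scale_pi scale1r. Qed.
Fact quotmod_scaleDr : right_distributive quotmod_scale +%R.
Proof.
move=> a p q; have [x <-] := quotmod_surj p; have [y <-] := quotmod_surj q.
by rewrite -quotmod_piD !quotmod_scale_pi scalerDr quotmod_piD.
Qed.
Fact quotmod_scaleDl q : {morph quotmod_scale^~ q : a b / a + b}.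
Proof.
by move=> a b; have [x <-] := quotmod_surj q; rewrite !quotmod_scale_pi scalerDl quotmod_piD.
Qed.
HB.instance Definition _ := GRing.Zmodule_isLmodule.Build R Q
  quotmod_scaleA quotmod_scale1 quotmod_scaleDr quotmod_scaleDl.

Fact quotmod_pi_linear : linear quotmod_pi.
Proof. by move=> a x y; rewrite quotmod_piD -quotmod_scale_pi. Qed.
HB.instance Definition _ := GRing.isLinear.Build R V Q *:%R quotmod_pi quotmod_pi_linear.

Lemma quotmod_pi_eq0 x : quotmod_pi x = 0 <-> x \in S.
Proof. by rewrite -(raddf0 quotmod_pi) quotmod_eq subr0. Qed.
End QuotientModule.


(** Quotients of abelian groups serve only to test membership in a subgroup by
    the vanishing of an additive map. *)
Lemma quotient_additive (G : zmodType) (A : {pred G}) : zmod_closed A ->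
  exists (Q : zmodType) (p : {additive G -> Q}), forall x, p x = 0 <-> x \in A.
Proof.
move=> clA; pose cA := GRing.isZmodClosed.Build G A clA.
pose sA : zmodClosed G := HB.pack A cA.
exists (Quotient.quot sA), (\pi_(Quotient.quot sA)) => x.
have -> : (x \in A) = (\pi_(Quotient.quot sA) x == 0).
  rewrite -[x in LHS]subr0 -(raddf0 (\pi_(Quotient.quot sA))).
  by rewrite -[LHS]/(_ \in sA) Quotient.idealrBE.
by split=> /eqP.
Qed.

(** * Tensor products and right exactness *)

Section TensorFacts.
Variables (R : pzRingType) (M : rmodType R).

Section OneFactor.
Variable N : lmodType R.
Local Notation T := (tensor M N).

Lemma tensDl m m' (n : N) : tens (m + m' : M) n = tens m n + tens m' n.
Proof. by case: (tens_balanced M N). Qed.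
Lemma tensDr (m : M) (n n' : N) : tens m (n + n') = tens m n + tens m n'.
Proof. by case: (tens_balanced M N). Qed.
Lemma tensZ (m : M) (r : R) (n : N) : tens ((r : R^c) *: m) n = tens m (r *: n).
Proof. by case: (tens_balanced M N). Qed.

Lemma tens0l (n : N) : tens (0 : M) n = 0.
Proof. by apply: (addrI (tens (0 : M) n)); rewrite -tensDl !addr0. Qed.
Lemma tens0r (m : M) : tens m (0 : N) = 0.
Proof. by apply: (addrI (tens m (0 : N))); rewrite -tensDr !addr0. Qed.

Lemma tens_suml (J : Type) (s : seq J) (f : J -> M) (n : N) :
  tens (\sum_(j <- s) f j) n = \sum_(j <- s) tens (f j) n.
Proof. exact: (big_morph (fun m => tens m n) (fun x y => tensDl x y n) (tens0l n)). Qed.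
(** Both the projection onto the quotient by [A] and the zero map lift the zero
    balanced map, so they agree. *)
Lemma tensor_ind (A : {pred T}) : zmod_closed A ->
  (forall m n, tens m n \in A) -> forall z, z \in A.
Proof.
move=> clA tA z.
have [Q [p pA]] := quotient_additive clA.
have bal : balanced (fun (m : M) (n : N) => 0 : Q) by split=> *; rewrite ?addr0.
have pi0 m n : p (tens m n) = 0 by apply/pA; exact: tA.
have e := tensor_lift_unique bal pi0.
have e0 := tensor_lift_unique bal (h := \0) (fun m n => erefl).
by apply/pA; rewrite e -e0.
Qed.
End OneFactor.

Lemma eq_tensor (N : lmodType R) (G : zmodType) (f g : tensor M N -> G) :
  zmod_morphism f -> zmod_morphism g ->
  (forall m n, f (tens m n) = g (tens m n)) -> f =1 g.
Proof.
move=> fB gB fg z; apply/eqP.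
apply: (tensor_ind (A := [pred z | f z == g z])) => [|m n].
  split=> [|x y]; rewrite !inE.
    by rewrite -(subrr 0) fB gB !subrr.
  by rewrite fB gB => /eqP-> /eqP->.
by rewrite inE fg.
Qed.

End TensorFacts.

Section RightExactness.
Variables (R : pzRingType) (M : rmodType R) (A B C : lmodType R).
Variables (f : {linear A -> B}) (g : {linear B -> C}).
Hypothesis fg : short_exact f g.

Lemma tensor_map_comp0 z : tensor_map g (tensor_map f z : tensor M B) = 0.
Proof.
apply: (eq_tensor (f := fun z => tensor_map g (tensor_map f z : tensor M B)) (g := fun=> 0)).
- by move=> x y; rewrite !tensor_map_additive.
- by move=> x y; rewrite subr0.
move=> m a; rewrite !tensor_map_tens.
case: fg => _ ex _; have -> : g (f a) = 0 by apply/ex; exists a.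
exact: tens0r.
Qed.

(** Preimages under [g] define a map back from [M (x) C] to the cokernel of
    [M (x) f], so an element killed by [M (x) g] dies in that cokernel. *)
Lemma tensor_map_exact (z : tensor M B) :
  tensor_map g z = 0 -> exists y : tensor M A, tensor_map f y = z.
Proof.
case: fg => finj ex gsurj.
pose im : {pred tensor M B} := fun z => `[< exists y : tensor M A, tensor_map f y = z >].
have clim : zmod_closed im.
  split=> [|x y /asboolP[x' <-] /asboolP[y' <-]]; apply/asboolP.
    by exists 0; rewrite -(subrr 0) tensor_map_additive subrr.
  by exists (x' - y'); rewrite tensor_map_additive.
have [Q [p p_eq0]] := quotient_additive clim.
have pf m a : p (tens m (f a)) = 0.
  by apply/p_eq0/asboolP; exists (tens m a); rewrite tensor_map_tens.
pose g' c := projT1 (cid (gsurj c)).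
have gK c : g (g' c) = c by rewrite /g'; case: cid.
have pg m b b' : g b = g b' -> p (tens m b) = p (tens m b').
  move=> e; have /ex[a fa] : g (b - b') = 0 by rewrite raddfB /= e subrr.
  by rewrite -[b](subrK b') tensDr -fa raddfD /= pf add0r.
pose lft (m : M) c : Q := p (tens m (g' c)).
have bal : balanced lft.
  rewrite /lft; split=> [m m' c|m c c'|m r c].
  - by rewrite tensDl raddfD.
  - by rewrite -raddfD -tensDr; apply: pg; rewrite raddfD /= !gK.
  - by rewrite tensZ; apply: pg; rewrite linearZ /= !gK.
have e : (fun z => tensor_lift lft (tensor_map g z)) =1 p.
  apply: eq_tensor => [x y|x y|m b].
  - by rewrite tensor_map_additive (tensor_lift_additive bal).
  - by rewrite raddfB.
  - by rewrite tensor_map_tens (tensor_lift_tens bal); apply: pg; rewrite gK.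
move=> gz0; have : p z = 0.
  by rewrite -e gz0; exact: (zmod_morphism0 (tensor_lift_additive bal)).
by move=> /p_eq0/asboolP.
Qed.

Lemma tensor_map_surj : surj (tensor_map g : tensor M B -> tensor M C).
Proof.
case: fg => _ _ gsurj z.
apply/asboolP.
apply: (tensor_ind (A := fun z => `[< exists y : tensor M B, tensor_map g y = z >])).
  split=> [|x y /asboolP[x' <-] /asboolP[y' <-]]; apply/asboolP.
    by exists 0; rewrite -(subrr 0) tensor_map_additive subrr.
  by exists (x' - y'); rewrite tensor_map_additive.
move=> m c; apply/asboolP; have [b <-] := gsurj c.
by exists (tens m b); rewrite tensor_map_tens.
Qed.

Lemma tensor_short_exact :
  injective (tensor_map f : tensor M A -> tensor M B) ->
  short_exact (tensor_map f : tensor M A -> tensor M B) (tensor_map g).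
Proof.
move=> finj; split=> // [z|]; last exact: tensor_map_surj.
split; first exact: tensor_map_exact.
by move=> [y <-]; exact: tensor_map_comp0.
Qed.
End RightExactness.

(** * Locally projective modules *)

Notation "R %:mod" := (((R : pzRingType)^c)^o) (at level 2, format "R %:mod").

Section LocallyProjectiveModule.
Variables (R : pzRingType) (M : rmodType R).

Definition finrank (t : seq (M * {linear M -> R%:mod})) (x : M) : M :=
  \sum_(p <- t) (p.2 x : R^c) *: p.1.

Fact finrank_linear t : linear (finrank t).
Proof.
move=> a x y; rewrite /finrank scaler_sumr -big_split /=; apply: eq_bigr => p _.
by rewrite linearP scalerDl -scalerA.
Qed.
HB.instance Definition _ t :=
  GRing.isLinear.Build _ M M *:%R (finrank t) (finrank_linear t).

(** A dual basis lemma that holds one element at a time: the finite family of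
    vectors and functionals may depend on the element. *)
Definition locally_projective : Prop := forall x : M, exists t, x = finrank t x.

(** One finite rank map fixes finitely many elements: if [f] fixes the previous
    ones and [g] fixes [x - f x], then [f + g (1 - f)] fixes them all. *)
Lemma locally_projective_seq : locally_projective ->
  forall s : seq M, exists t, forall x, x \in s -> x = finrank t x.
Proof.
move=> lpM; elim=> [|x s [t tP]]; first by exists [::].
pose co : {linear M -> M} := (idfun \- finrank t)%R.
have [t' t'P] := lpM (co x).
pose tail (p : M * {linear M -> R%:mod}) :=
  (p.1, (p.2 \o co)%FUN : {linear M -> R%:mod}).
exists (t ++ map tail t') => z zs.
rewrite /finrank big_cat big_map /= -/(finrank t z) -/(finrank t' (co z)).
move: zs; rewrite inE => /orP[/eqP->|/tP zE].
  by rewrite -t'P /co /= addrC subrK.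
by rewrite -[co z]/(z - finrank t z) -zE subrr raddf0 addr0.
Qed.
End LocallyProjectiveModule.

Section LocallyProjective.
Variables (R : pzRingType) (M : rmodType R).

Section Contraction.
Variables (Q : lmodType R) (phi : {linear M -> R%:mod}).

Lemma contract_balanced : balanced (fun (m : M) (q : Q) => (phi m : R) *: q).
Proof.
split=> [m m' q|m q q'|m r q].
- by rewrite raddfD /= -scalerDl.
- by rewrite scalerDr.
- by rewrite linearZ /= scalerA.
Qed.

Definition contract : tensor M Q -> Q := tensor_lift (fun m q => (phi m : R) *: q).

Lemma contract_tens m q : contract (tens m q) = (phi m : R) *: q.
Proof. exact: tensor_lift_tens contract_balanced _ _. Qed.

Lemma contract_additive : zmod_morphism contract.
Proof. exact: tensor_lift_additive contract_balanced. Qed.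

Lemma contract0 : contract 0 = 0.
Proof. by rewrite -(subrr 0) contract_additive subrr. Qed.
End Contraction.

Hypothesis lpM : locally_projective M.

(** Choose a finite rank map [sum_k v_k phi_k] fixing the left factors of an
    expression of [z]; moving the scalars [phi_k m] across the tensor sign gives
    the formula. *)
Lemma contract_expand (Q : lmodType R) (z : tensor M Q) :
  exists t : seq (M * {linear M -> R%:mod}),
    z = \sum_(p <- t) tens p.1 (contract p.2 z).
Proof.
suff [s /(_ _)sP] : exists s : seq M, forall t : seq (M * {linear M -> R%:mod}),
    (forall x, x \in s -> x = finrank t x) ->
    z = \sum_(p <- t) tens p.1 (contract p.2 z).
  by have [t tP] := locally_projective_seq lpM s; exists t; exact: sP.
pose A : {pred tensor M Q} := fun z => `[< exists s : seq M,
  forall t : seq (M * {linear M -> R%:mod}),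
    (forall x, x \in s -> x = finrank t x) ->
    z = \sum_(p <- t) tens p.1 (contract p.2 z) >].
apply/asboolP; apply: (tensor_ind (A := A)) => [|m q].
  split; first apply/asboolP.
    exists [::] => t _; rewrite big1// => p _.
    by rewrite contract0 tens0r.
  move=> x y /asboolP[s sP] /asboolP[s' sP']; apply/asboolP.
  exists (s ++ s') => t tP.
  rewrite {1}(sP t) => [|u us]; last by apply: tP; rewrite mem_cat us.
  rewrite {1}(sP' t) => [|u us]; last by apply: tP; rewrite mem_cat us orbT.
  rewrite -sumrB; apply: eq_bigr => p _; rewrite contract_additive.
  apply/eqP; rewrite subr_eq -tensDr subrK; exact/eqP.
apply/asboolP; exists [:: m] => t /(_ m (mem_head _ _)) {1}->.
rewrite /finrank tens_suml; apply: eq_bigr => p _.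
by rewrite contract_tens tensZ.
Qed.

Lemma contract_separates (Q : lmodType R) (z : tensor M Q) :
  (forall phi : {linear M -> R%:mod}, contract phi z = 0) -> z = 0.
Proof.
move=> z0; have [t ->] := contract_expand z.
by rewrite big1// => p _; rewrite z0 tens0r.
Qed.
End LocallyProjective.

Section FlatMittagLeffler.
Variables (R : pzRingType) (M : rmodType R).

Lemma contract_map (A B : lmodType R) (f : {linear A -> B}) (phi : {linear M -> R%:mod}) z :
  contract phi (tensor_map f z) = f (contract phi z).
Proof.
apply: (eq_tensor (f := fun z => contract phi (tensor_map f z))
                  (g := fun z => f (contract phi z))) => [x y|x y|m a].
- by rewrite tensor_map_additive contract_additive.
- by rewrite contract_additive raddfB.
- by rewrite tensor_map_tens !contract_tens linearZ.
Qed.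

Lemma contract_prod (I : Type) (Q : I -> lmodType R) (phi : {linear M -> R%:mod}) i
    (z : tensor M (dprod Q)) :
  contract phi (tensor_prod z i) = contract phi z i.
Proof.
apply: (eq_tensor (f := fun z => contract phi (tensor_prod z i))
                  (g := fun z : tensor M (dprod Q) => contract phi z i)) => [x y|x y|m a].
- by rewrite tensor_prod_additive contract_additive.
- by rewrite contract_additive.
- by rewrite tensor_prod_tens !contract_tens.
Qed.

(** The contractions of [M (x) Q] along all functionals are natural in [Q] and
    jointly injective, so [M (x) -] embeds into a product of copies of the
    identity functor, naturally. *)
Lemma locally_projective_flat_mittag_leffler :
  locally_projective M -> flat_mittag_leffler M.
Proof.
move=> lpM; split.
  move=> A B C f g fg; apply: tensor_short_exact => //.
  apply: zmod_morphism_inj; first exact: tensor_map_additive.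
  move=> z fz0; apply: (contract_separates lpM) => phi.
  case: fg => finj _ _; apply: finj.
  by rewrite -contract_map fz0 raddf0 contract0.
move=> I Q; apply: zmod_morphism_inj; first exact: tensor_prod_additive.
move=> z z0; apply: (contract_separates lpM) => phi.
apply: functional_extensionality_dep => i.
by rewrite -contract_prod z0 contract0.
Qed.
End FlatMittagLeffler.

(** * Direct sums of modules generated by idempotents *)

Section DirectSum.
Variables (R : pzRingType) (I : Type) (e : I -> R).
Local Notation E := (dprod (fun _ : I => R%:mod)).

(** For idempotents [e i], the functions of finite support with [f i] in
    [e i R] form the direct sum of the right ideals [e i R]; the constant family
    [1] gives the free module on [I]. *)
Definition dsum_pred : {pred E} := fun f =>
  `[< finsupp f /\ forall i, e i * (f i : R) = f i >].

Fact dsum_closed : submod_closed dsum_pred.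
Proof.
split=> [|a f g /asboolP[ff ef] /asboolP[fg eg]]; apply/asboolP; split.
- by exists [::].
- by move=> i; exact: mulr0.
- case: ff fg => [s sP] [t tP]; exists (s ++ t) => i fgi; rewrite mem_cat.
  have [fi|/sP-> //] := pselect (f i = 0); rewrite (tP i) ?orbT// => gi; apply: fgi.
  by rewrite -[LHS]/(a *: f i + g i) fi gi scaler0 addr0.
- move=> i; rewrite -[X in e i * X]/((f i : R) * a + g i) mulrDr mulrA ef eg.
  by [].
Qed.

Definition dsum : Type := submodule dsum_closed.
HB.instance Definition _ := GRing.Lmodule.on dsum.

Definition dsum_coord (f : dsum) : I -> R := submod_val (clS := dsum_closed) f.

Lemma dsum_finsupp (f : dsum) : finsupp (dsum_coord f : I -> R^c).
Proof. by have /asboolP[] := submod_valP (clS := dsum_closed) f. Qed.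
Lemma dsum_coord_fix (f : dsum) i : e i * dsum_coord f i = dsum_coord f i.
Proof. by have /asboolP[_] := submod_valP (clS := dsum_closed) f. Qed.
Lemma dsum_coord_inj (f g : dsum) : dsum_coord f =1 dsum_coord g -> f = g.
Proof.
move=> fg; apply: (@submod_val_inj _ _ _ dsum_closed).
exact: functional_extensionality_dep.
Qed.

Lemma dsum_coordZ (f : dsum) (a : R) j : dsum_coord ((a : R^c) *: f) j = dsum_coord f j * a.
Proof. by []. Qed.

Section Extension.
Variables (V : rmodType R) (v : I -> V).

Definition dsum_ext (f : dsum) : V := fsum (fun i => (dsum_coord f i : R^c) *: v i).

Fact dsum_ext_linear : linear dsum_ext.
Proof. by move=> a f g; rewrite /dsum_ext -fsum_linear//; exact: dsum_finsupp. Qed.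
HB.instance Definition _ :=
  GRing.isLinear.Build _ dsum V *:%R dsum_ext dsum_ext_linear.
End Extension.

Definition dsum_proj i (f : dsum) : R%:mod := dsum_coord f i.
Fact dsum_proj_linear i : linear (dsum_proj i).
Proof. by []. Qed.
HB.instance Definition _ i :=
  GRing.isLinear.Build _ dsum (R%:mod) *:%R (dsum_proj i) (dsum_proj_linear i).

Hypothesis e_idem : forall i, e i * e i = e i.

Definition dsum_gen_fun (i : {classic I}) : E :=
  fun j : {classic I} => if j == i then e i else 0.

Fact dsum_gen_subproof i : dsum_gen_fun i \in dsum_pred.
Proof.
apply/asboolP; split.
  exists [:: i] => j; rewrite /dsum_gen_fun inE; by case: eqP.
move=> j; rewrite /dsum_gen_fun; case: eqP => [->|_]; first exact: e_idem.
exact: mulr0.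
Qed.

Definition dsum_gen i : dsum := submod_mk dsum_closed (dsum_gen_subproof i).

Lemma dsum_gen_coord i : dsum_coord (dsum_gen i) i = e i.
Proof. by rewrite -[LHS]/(dsum_gen_fun i i) /dsum_gen_fun eqxx. Qed.
Lemma dsum_gen_coord0 i j : j <> i -> dsum_coord (dsum_gen i) j = 0.
Proof. by rewrite -[dsum_coord _ _]/(dsum_gen_fun i j) /dsum_gen_fun; case: eqP. Qed.

Lemma dsum_ext_gen (V : rmodType R) (v : I -> V) i :
  dsum_ext v (dsum_gen i) = (e i : R^c) *: v i.
Proof.
rewrite /dsum_ext (@fsum_eq1 _ _ _ i) ?dsum_gen_coord// => j /dsum_gen_coord0->.
exact: scale0r.
Qed.

Lemma dsum_expand (f : dsum) : f = fsum (fun i => (dsum_coord f i : R^c) *: dsum_gen i).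
Proof.
apply: dsum_coord_inj => j; rewrite -[RHS]/(dsum_proj j (fsum _)).
rewrite fsum_morph; last exact/finsupp_scale/dsum_finsupp.
rewrite (@fsum_eq1 _ _ _ j) => [|i ij].
  by rewrite -[RHS]/(dsum_coord (_ *: _) j) dsum_coordZ dsum_gen_coord dsum_coord_fix.
rewrite -[LHS]/(dsum_coord (_ *: _) j) dsum_coordZ dsum_gen_coord0 ?mul0r//.
exact: nesym.
Qed.

Lemma dsum_linear_ext (V : rmodType R) (h : {linear dsum -> V}) f :
  h f = dsum_ext (fun i => h (dsum_gen i)) f.
Proof.
rewrite {1}(dsum_expand f) fsum_morph; last exact/finsupp_scale/dsum_finsupp.
by congr fsum; apply: funext => i; rewrite /= linearZ.
Qed.

Lemma dsum_projective : projective dsum.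
Proof.
move=> A B g h gsurj.
have a i : {a | g a = h (dsum_gen i)} by exact/cid/gsurj.
exists (dsum_ext (fun i => sval (a i))) => f.
rewrite dsum_linear_ext /= /dsum_ext fsum_morph; last exact/finsupp_scale/dsum_finsupp.
by congr fsum; apply: funext => i; rewrite /= linearZ; case: (a i) => /= x ->.
Qed.

End DirectSum.

(** A projective module is a retract of the free module on its elements, whose
    coordinates give a dual basis. *)
Lemma projective_locally_projective (R : pzRingType) (P : rmodType R) :
  projective P -> locally_projective P.
Proof.
move=> projP x.
have idem (i : P) : 1 * 1 = 1 :> R by exact: mulr1.
pose p := dsum_ext (e := fun _ : P => 1 : R) (fun y : P => y).
have [|s sK] := projP _ _ p idfun.
  by move=> y; exists (dsum_gen idem y); rewrite /p /= dsum_ext_gen scale1r.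
have [u [uu uP]] := finsuppP (finsupp_scale (fun y : P => y) (dsum_finsupp (s x))).
pose tail y := (y, (dsum_proj y \o s)%FUN : {linear P -> R%:mod}).
exists (map tail u).
by rewrite /finrank big_map [LHS]sK /= /p /dsum_ext (fsumE uu uP).
Qed.

(** * Flat modules over a right perfect ring *)

Section FreeModule.
Variables (R : pzRingType) (M : rmodType R).

Definition free_cover := dsum_ext (e := fun _ : M => 1 : R) (fun y : M => y).
HB.instance Definition _ := GRing.Linear.on free_cover.

Lemma free_cover_surj : surj free_cover.
Proof.
move=> y; exists (dsum_gen (fun=> mulr1 1 : 1 * 1 = 1 :> R) y).
by rewrite /free_cover dsum_ext_gen scale1r.
Qed.

Lemma free_projective : projective (dsum (fun _ : M => 1 : R)).
Proof. by apply: dsum_projective => i; exact: mulr1. Qed.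
End FreeModule.

Lemma submodule_short_exact (R : pzRingType) (V : lmodType R) (S : {pred V})
    (clS : submod_closed S) :
  short_exact (@submod_val _ _ _ clS) (@quotmod_pi _ _ _ clS).
Proof.
split; [exact: submod_val_inj | | exact: quotmod_surj].
move=> x; rewrite quotmod_pi_eq0; split=> [xS|[y <-]]; last exact: submod_valP.
by exists (submod_mk clS xS).
Qed.

Section FlatQuotient.
Variables (R : pzRingType) (P M : rmodType R) (p : {linear P -> M}).
Hypotheses (psurj : surj p) (flatM : flat M).

(** For [K = ker p] and the left ideal [I = sum R r_i], flatness of [M = P / K]
    says that [K] meets [P I] in [K I].  The lemma is proved by mapping
    [M (x) I] to [P / K I] by [p y (x) t |-> y t]: the element
    [sum p v_i (x) r_i] is zero because its image in [M (x) R = M] is, and it is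
    mapped to the class of [sum v_i r_i]. *)
Lemma flat_kernel_solution n (v : 'I_n -> P) (r : 'I_n -> R) :
  p (\sum_i (r i : R^c) *: v i) = 0 ->
  exists k : 'I_n -> P, (forall i, p (k i) = 0) /\
    \sum_i (r i : R^c) *: v i = \sum_i (r i : R^c) *: k i.
Proof.
move=> px0.
pose I : {pred R^o} := fun x => `[< exists t : 'I_n -> R, x = \sum_i t i * r i >].
have clI : submod_closed I.
  split=> [|a x y /asboolP[s ->] /asboolP[t ->]]; apply/asboolP.
    by exists (fun=> 0); rewrite big1// => i _; exact: mul0r.
  exists (fun i => a * s i + t i); rewrite -[a *: _]/(a * _) mulr_sumr -big_split /=.
  by apply: eq_bigr => i _; rewrite mulrDl mulrA.
pose H : {pred P} := fun z => `[< exists k : 'I_n -> P,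
  (forall i, p (k i) = 0) /\ z = \sum_i (r i : R^c) *: k i >].
have clH : zmod_closed H.
  split=> [|x y /asboolP[k [k0 ->]] /asboolP[l [l0 ->]]]; apply/asboolP.
    exists (fun=> 0); split=> [i|]; first exact: raddf0.
    by rewrite big1// => i _; exact: scaler0.
  exists (fun i => k i - l i); split=> [i|]; first by rewrite raddfB /= k0 l0 subrr.
  by rewrite -sumrB; apply: eq_bigr => i _; rewrite scalerBr.
have [G [q q_eq0]] := quotient_additive clH.
pose p' m := projT1 (cid (psurj m)).
have pK m : p (p' m) = m by rewrite /p'; case: cid.
pose b (m : M) (i : submodule clI) : G :=
  q ((submod_val i : R^c) *: p' m).
have qK (i : submodule clI) x y : p x = p y ->
    q ((submod_val i : R^c) *: x) = q ((submod_val i : R^c) *: y).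
  move=> pxy; apply/eqP; rewrite -subr_eq0 -raddfB; apply/eqP/q_eq0/asboolP.
  have /asboolP[t ->] := submod_valP i.
  exists (fun j => (t j : R^c) *: (x - y)); split=> [j|].
    by rewrite linearZ /= raddfB /= pxy subrr scaler0.
  rewrite -scalerBr.
  rewrite (_ : (\sum_j t j * r j : R) = (\sum_j (r j : R^c) * (t j : R^c) : R^c))//.
  by rewrite scaler_suml; apply: eq_bigr => j _; rewrite scalerA.
have bal : balanced b.
  rewrite /b; split=> [m m' i|m i j|m a i].
  - by rewrite -raddfD -scalerDr; apply: qK; rewrite raddfD /= !pK.
  - rewrite -[submod_val (i + j)]/((submod_val i : R^c) + (submod_val j : R^c)).
    by rewrite scalerDl raddfD.
  - rewrite -[submod_val (a *: i)]/((submod_val i : R^c) * (a : R^c)) -scalerA.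
    by apply: qK; rewrite linearZ /= !pK.
have rI i : r i \in I.
  apply/asboolP; exists (fun j => if j == i then 1 else 0).
  rewrite (bigD1 i)//= eqxx mul1r big1 ?addr0// => j /negPf->; exact: mul0r.
pose z : tensor M (submodule clI) := \sum_i tens (p (v i)) (submod_mk clI (rI i)).
have z0 : z = 0.
  have [inj _ _] := flatM (submodule_short_exact clI).
  apply: inj; rewrite (zmod_morphism0 (tensor_map_additive _)).
  rewrite (zmod_morphism_sum (tensor_map_additive _)).
  rewrite (eq_bigr (fun i => tens (p ((r i : R^c) *: v i)) (1 : R^o))) => [|i _].
    have e : \sum_i p ((r i : R^c) *: v i) = 0 by rewrite -raddf_sum.
    by rewrite -tens_suml e tens0l.
  rewrite tensor_map_tens linearZ tensZ; congr tens.
  by rewrite -[RHS]/(r i * 1) mulr1.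
have := tensor_lift_additive bal => bB.
have : tensor_lift b z = 0 by rewrite z0 (zmod_morphism0 bB).
rewrite (zmod_morphism_sum bB) (eq_bigr (fun i => q ((r i : R^c) *: v i))) => [|i _].
  by rewrite -raddf_sum => /q_eq0/asboolP.
by rewrite (tensor_lift_tens bal); apply: qK; rewrite pK.
Qed.
End FlatQuotient.

Lemma bijective_projective (R : pzRingType) (P M : rmodType R) (p : {linear P -> M}) :
  projective P -> surj p -> (forall x, p x = 0 -> x = 0) -> projective M.
Proof.
move=> projP psurj p0 A B g h gsurj.
have pinj : injective p by apply: zmod_morphism_inj => // x y; exact: raddfB.
have [k kP] := projP _ _ g (h \o p)%FUN gsurj.
pose p' m := projT1 (cid (psurj m)).
have pK m : p (p' m) = m by rewrite /p'; case: cid.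
have p'lin : linear p' by move=> a x y; apply: pinj; rewrite linearP !pK.
pose cp := GRing.isLinear.Build _ _ _ _ p' p'lin.
pose p'L : {linear M -> P} := HB.pack p' cp.
exists (k \o p'L)%FUN => m; rewrite /= -[RHS]/((g \o k)%FUN (p' m)) -kP /=.
by rewrite pK.
Qed.

Lemma image_closed (R : pzRingType) (U V : lmodType R) (f : {linear U -> V}) :
  submod_closed (fun y => `[< exists x, f x = y >] : bool).
Proof.
split=> [|a x y /asboolP[x' <-] /asboolP[y' <-]]; apply/asboolP.
  by exists 0; exact: raddf0.
by exists (a *: x' + y'); rewrite linearP.
Qed.

(** The kernel of [1 - theta], for a finite rank [theta : P -> ker p] fixing
    [x], is a direct summand of [P] lying in the superfluous submodule [ker p];
    hence it is zero. *)
Lemma projective_cover_flat_inj (R : pzRingType) (P M : rmodType R) (p : {linear P -> M}) :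
  projective_cover p -> flat M -> forall x, p x = 0 -> x = 0.
Proof.
move=> [projP psurj supK] flatM x px0.
have [t xE] := projective_locally_projective projP x.
pose n := size t; pose T := tnth (in_tuple t).
have xE' : x = \sum_(i < n) ((T i).2 x : R^c) *: (T i).1.
  by rewrite {1}xE /finrank big_tnth.
have [|k [k0 kE]] := flat_kernel_solution psurj flatM
  (v := fun i => (T i).1) (r := fun i => (T i).2 x).
  by rewrite -xE'.
rewrite -xE' in kE.
pose theta : {linear P -> P} :=
  finrank [seq (k i, (T i).2) | i <- index_enum 'I_n].
have thetaE y : theta y = \sum_i ((T i).2 y : R^c) *: k i.
  by rewrite /theta /= /finrank big_map.
have theta_ker y : p (theta y) = 0.
  rewrite thetaE raddf_sum big1// => i _.
  by rewrite /= linearZ /= k0 scaler0.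
(* [d y + theta y = y] with [theta y] in [ker p]: superfluity makes [d] onto. *)
pose d : {linear P -> P} := (idfun \- theta)%R.
have dE y : d y = y - theta y by [].
clearbody d.
have dsurj : surj d.
  move=> z; apply/asboolP; move: z; apply: supK; first exact: image_closed.
  move=> z; exists (d z), (theta z); split=> //; last by rewrite dE subrK.
  by apply/asboolP; exists z.
have [s sK] := projP _ _ d idfun dsurj.
have dsE y : d (s y) = y by rewrite [RHS](sK y).
(* [z - s (d z)] is killed by [d], hence equals its image under [theta], which
   lies in [ker p]: superfluity applies again, now to the image of [s]. *)
have ssurj : surj s.
  move=> z; apply/asboolP; move: z; apply: supK; first exact: image_closed.
  move=> z; exists (s (d z)), (z - s (d z)); split; last by rewrite addrC subrK.
    by apply/asboolP; exists (d z).
  have : d (z - s (d z)) = 0 by rewrite raddfB /= dsE subrr.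
  by move=> /(congr1 p); rewrite dE raddfB /= theta_ker subr0 raddf0.
have [w xw] := ssurj x.
have : d x = 0 by rewrite dE thetaE -kE subrr.
by rewrite -xw dsE => ->; exact: raddf0.
Qed.

Lemma right_perfect_flat_projective (R : pzRingType) (M : rmodType R) :
  right_perfect R -> flat M -> projective M.
Proof.
move=> perf flatM; have [P [p pc]] := perf M.
have [projP psurj _] := pc.
exact: bijective_projective (projective_cover_flat_inj pc flatM).
Qed.

Lemma right_perfect_precovering (R : pzRingType) :
  right_perfect R -> precovering (@flat_mittag_leffler R).
Proof.
move=> perf M; exists (dsum (fun _ : M => 1 : R)), (@free_cover R M).
split.
  apply/locally_projective_flat_mittag_leffler/projective_locally_projective.
  exact: free_projective.
move=> D f [flatD _].
exact: (right_perfect_flat_projective perf flatD) (@free_cover_surj R M).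
Qed.

(** * Tree modules *)

Definition eventually (P : nat -> Prop) : Prop := exists N, forall n, (N <= n)%N -> P n.

Lemma eventually_and (P Q : nat -> Prop) :
  eventually P -> eventually Q -> eventually (fun n => P n /\ Q n).
Proof.
move=> [M MP] [N NQ]; exists (maxn M N) => n; rewrite geq_max => /andP[Mn Nn].
by split; [exact: MP | exact: NQ].
Qed.

Lemma eventually_all (A : eqType) (s : seq A) (P : A -> nat -> Prop) :
  (forall x, x \in s -> eventually (P x)) ->
  eventually (fun n => forall x, x \in s -> P x n).
Proof.
elim: s => [|y s IH] sP; first by exists 0%N.
have [|N NP] := IH; first by move=> x xs; apply: sP; rewrite inE xs orbT.
have [|M MP] := sP y; first exact: mem_head.
exists (maxn M N) => n; rewrite geq_max => /andP[Mn Nn] x.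
by rewrite inE => /orP[/eqP->|xs]; [exact: MP | exact: NP].
Qed.

Section TreeModule.
Variables (R : pzRingType) (a : nat -> R).

(** The product [a_(n+k-1) ... a_n], as a map from the [n]-th to the [(n+k)]-th
    term of the direct system [R -> R -> R -> ...] of multiplications by the
    [a_i]. *)
Fixpoint chain (n k : nat) : R := if k is k'.+1 then a (n + k') * chain n k' else 1.

Lemma chainSr n k : chain n k.+1 = chain n.+1 k * a n.
Proof.
elim: k => [|k IH]; first by rewrite /= addn0 mulr1 mul1r.
by rewrite -[LHS]/(a (n + k.+1) * chain n k.+1) IH mulrA addnS.
Qed.

Definition germ_zero : {pred dprod (fun _ : nat => R%:mod)} :=
  fun u => `[< eventually (fun n => u n = 0) >].

Fact germ_zero_closed : submod_closed germ_zero.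
Proof.
split=> [|c u v /asboolP uP /asboolP vP]; apply/asboolP; first by exists 0%N.
have [N NP] := eventually_and uP vP; exists N => n /NP[un vn].
by rewrite -[LHS]/(c *: u n + v n) un vn scaler0 addr0.
Qed.

(** The colimit of the direct system, the flat module whose failure to be
    projective is at stake, embeds in this larger quotient, which does not
    depend on [a]. *)
Definition germ : Type := quotmod germ_zero_closed.
HB.instance Definition _ := GRing.Lmodule.on germ.
Definition germ_of (u : dprod (fun _ : nat => R%:mod)) : germ := quotmod_pi germ_zero_closed u.
Fact germ_of_linear : linear germ_of.
Proof. exact: quotmod_pi_linear. Qed.
HB.instance Definition _ := GRing.isLinear.Build _ _ germ *:%R germ_of germ_of_linear.
Lemma germ_eq0 u : germ_of u = 0 <-> eventually (fun n => u n = 0).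
Proof. by rewrite /germ_of quotmod_pi_eq0; split=> [/asboolP|uP]//; apply/asboolP. Qed.

(** The image in [germ] of the generator of the [n]-th term of the direct system;
    one has [chain_germ n = chain_germ (n + 1) a_n]. *)
Definition chain_germ n : germ :=
  germ_of (fun m => if (n <= m)%N then chain n (m - n) else 0).

Variables (T X : Type) (level : T -> nat) (node : X -> nat -> T).
Hypothesis level_node : forall x n, level (node x n) = n.
Hypothesis branches_separate :
  forall x y, x <> y -> eventually (fun n => node x n <> node y n).

Local Notation E := (dprod (fun _ : T => R%:mod)).

(** This submodule is spanned by the unit vectors of the vertices and by the
    [limb]s below.  The three conditions are visibly stable under linear
    combinations: finitely many nonzero values below each height, a support
    that eventually lies on finitely many branches, and eventual compatibility
    with the direct system along each branch. *)
Definition tree_pred : {pred E} := fun l => `[<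
  [/\ forall N, exists F : seq {classic T}, forall t : {classic T},
        (level t < N)%N -> l t <> 0 -> t \in F,
      exists B : seq {classic X}, eventually (fun N => forall t,
        (N <= level t)%N -> l t <> 0 ->
        exists2 x : {classic X}, x \in B & t = node x (level t))
    & forall x, eventually (fun n => l (node x n.+1) = a n * l (node x n) :> R)] >].

Fact tree_closed : submod_closed tree_pred.
Proof.
have nz (c : R^c) (u v : R%:mod) : c *: u + v <> 0 -> u <> 0 \/ v <> 0.
  have [->|] := pselect (u = 0); last by left.
  by rewrite scaler0 add0r; right.
split=> [|c l l' /asboolP[fl sl cl] /asboolP[fl' sl' cl']]; apply/asboolP; split.
- by exists [::].
- by exists [::]; exists 0%N.
- by move=> x; exists 0%N => n _; rewrite mulr0.
- move=> N; have [F FP] := fl N; have [F' FP'] := fl' N.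
  exists (F ++ F') => t tN /nz[lt|lt]; rewrite mem_cat; first by rewrite FP.
  by rewrite FP' ?orbT.
- have [B bl] := sl; have [B' bl'] := sl'; exists (B ++ B').
  have [N NP] := eventually_and bl bl'; exists N => n /NP[nB nB'] t nt /nz[lt|lt].
    by have [x xB te] := nB t nt lt; exists x; rewrite // mem_cat xB.
  by have [x xB te] := nB' t nt lt; exists x; rewrite // mem_cat xB orbT.
- move=> x; have [N NP] := eventually_and (cl x) (cl' x).
  exists N => n /NP[e e']; rewrite -[LHS]/((l (node x n.+1) : R) * c + l' (node x n.+1)).
  by rewrite e e' -mulrA -mulrDr.
Qed.

Definition tree_module : Type := submodule tree_closed.
HB.instance Definition _ := GRing.Lmodule.on tree_module.
Definition tree_val (l : tree_module) : E := submod_val (clS := tree_closed) l.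
Fact tree_val_linear : linear tree_val.
Proof. by []. Qed.
HB.instance Definition _ := GRing.isLinear.Build _ tree_module E *:%R tree_val tree_val_linear.

Lemma tree_val_inj (l l' : tree_module) : tree_val l =1 tree_val l' -> l = l'.
Proof.
by move=> e; apply: (@submod_val_inj _ _ _ tree_closed); exact: functional_extensionality_dep.
Qed.

Definition tree_eval t (l : tree_module) : R%:mod := tree_val l t.
Fact tree_eval_linear t : linear (tree_eval t).
Proof. by []. Qed.
HB.instance Definition _ t :=
  GRing.isLinear.Build _ tree_module (R%:mod) *:%R (tree_eval t) (tree_eval_linear t).

Definition vertex_fun t0 : E := fun t => if `[< t = t0 >] then 1 else 0.

Fact vertex_subproof t0 : vertex_fun t0 \in tree_pred.
Proof.
rewrite /vertex_fun; apply/asboolP; split.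
- by move=> N; exists [:: t0] => t _; case: asboolP => // ->; rewrite mem_head.
- exists [::]; exists (level t0).+1 => n nt t nlt; case: asboolP => // e.
  by move: nt; rewrite ltnNge -e nlt.
- move=> x; exists (level t0).+1 => n nt.
  have far m : (level t0 < m)%N -> node x m <> t0.
    by move=> lt e; move: lt; rewrite -e level_node ltnn.
  by rewrite !asboolF ?mulr0//; apply: far; rewrite // ltnW.
Qed.
Definition vertex t0 : tree_module := submod_mk tree_closed (vertex_subproof t0).

(** The part of the branch [x] from height [n] on, carrying the compatible
    sequence that starts with [1]. *)
Definition limb_fun x n : E := fun t =>
  if (n <= level t)%N && `[< t = node x (level t) >] then chain n (level t - n) else 0.

Lemma limb_fun_node x n m :
  limb_fun x n (node x m) = if (n <= m)%N then chain n (m - n) else 0.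
Proof.
rewrite /limb_fun level_node; case: leqP => //= nm.
by case: asboolP.
Qed.

Lemma limb_fun_other x y n : y <> x -> eventually (fun m => limb_fun x n (node y m) = 0).
Proof.
move=> /branches_separate[N NP]; exists N => m /NP yx.
by rewrite /limb_fun level_node; case: asboolP; rewrite ?andbF.
Qed.

Fact limb_subproof x n : limb_fun x n \in tree_pred.
Proof.
apply/asboolP; split.
- move=> N; exists [seq (node x i : {classic T}) | i <- iota 0 N] => t tN.
  rewrite /limb_fun; case: asboolP => [->|]; last by rewrite andbF.
  by move=> _; apply/mapP; exists (level t); rewrite // mem_iota.
- exists [:: x]; exists 0%N => _ _ t _.
  rewrite /limb_fun; case: asboolP; last by rewrite andbF.
  by move=> e _; exists x; rewrite ?mem_head.
- move=> y; have [->|yx] := pselect (y = x).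
    exists n => m nm; rewrite !limb_fun_node nm (leqW nm) (subSn nm) /=.
    by rewrite subnKC.
  have [N NP] := limb_fun_other n yx; exists N => m Nm.
  by rewrite !NP ?mulr0// leqW.
Qed.
Definition limb x n : tree_module := submod_mk tree_closed (limb_subproof x n).

Lemma limb_step x n : limb x n = vertex (node x n) + (a n : R^c) *: limb x n.+1.
Proof.
apply: tree_val_inj => t.
rewrite -[RHS]/(vertex_fun (node x n) t + (limb_fun x n.+1 t : R) * a n).
rewrite -[LHS]/(limb_fun x n t) /vertex_fun.
have [/asboolP tx|tx] := pselect (t = node x (level t)); last first.
  have -> : `[< t = node x n >] = false by apply/asboolP => e; apply: tx; rewrite e level_node.
  by rewrite /limb_fun; case: asboolP => // _; rewrite !andbF mul0r add0r.
rewrite /limb_fun tx !andbT; case: (ltngtP n (level t)) => [nt|nt|nt].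
- rewrite asboolF => [|e]; last by move: nt; rewrite e level_node ltnn.
  by rewrite add0r -chainSr subnSK.
- rewrite asboolF ?mul0r ?addr0// => e; by move: nt; rewrite e level_node ltnn.
- rewrite asboolT; first by rewrite nt subnn mul0r addr0.
  by rewrite nt; exact/asboolP.
Qed.

(** Beyond a certain height [N] the element [l] lives on finitely many branches,
    which are pairwise disjoint there and along which [l] is compatible.  So [l]
    is the sum of its finitely many vertices below [N] and of the limbs
    [limb x N], with coefficients the values of [l] at the vertices and at the
    [node x N]. *)
Lemma tree_locally_projective : locally_projective tree_module.
Proof.
move=> l.
have /asboolP[fl [B sl] cl] := submod_valP (clS := tree_closed) l.
have [N [Nl Nl' Nsep]] : exists N, [/\
    forall t, (N <= level t)%N -> tree_val l t <> 0 ->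
      exists2 x : {classic X}, x \in undup B & t = node x (level t),
    forall x, x \in undup B -> forall n, (N <= n)%N ->
      tree_val l (node x n.+1) = a n * tree_val l (node x n) :> R
  & forall x, x \in undup B -> forall y, y \in undup B -> x <> y ->
      forall n, (N <= n)%N -> node x n <> node y n].
  have ev1 : eventually (fun n => forall x : {classic X}, x \in undup B ->
      tree_val l (node x n.+1) = a n * tree_val l (node x n) :> R).
    by apply: eventually_all => x _; exact: cl.
  have ev2 : eventually (fun n => forall x : {classic X}, x \in undup B ->
      forall y : {classic X}, y \in undup B -> x <> y -> node x n <> node y n).
    apply: eventually_all => x _; apply: eventually_all => y _.
    have [->|xy] := pselect (x = y); first by exists 0%N.
    by have [N NP] := branches_separate xy; exists N => n /NP.
  have [N NP] := eventually_and sl (eventually_and ev1 ev2); exists N; split.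
  - move=> t Nt /((NP N (leqnn _)).1 t Nt)[x xB te].
    by exists x; rewrite ?mem_undup.
  - by move=> x xB n /NP[_ [e _]]; exact: e.
  - by move=> x xB y yB xy n /NP[_ [_ e]]; exact: e.
have [F FP] := fl N.
pose lower := [seq t <- undup F | (level t < N)%N].
pose at_vertex (u : {classic T}) :=
  (vertex u, (tree_eval u : {linear tree_module -> R%:mod})).
pose at_limb (x : {classic X}) :=
  (limb x N, (tree_eval (node x N) : {linear tree_module -> R%:mod})).
exists (map at_vertex lower ++ map at_limb (undup B)).
apply: tree_val_inj => t; rewrite /finrank big_cat !big_map /=.
rewrite -[RHS]/(tree_eval t _) raddfD !raddf_sum /=.
rewrite (eq_bigr (fun u => @GRing.mul R (vertex_fun u t) (tree_val l u) : R%:mod))//.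
rewrite [X in _ + X](eq_bigr (fun x =>
  @GRing.mul R (limb_fun x N t) (tree_val l (node x N)) : R%:mod))//.
have [tN|Nt] := ltnP (level t) N.
  rewrite [X in _ + X]big1 ?addr0 => [|x _]; last first.
    by rewrite /limb_fun leqNgt tN /= mul0r.
  have [lt0|lt] := pselect (tree_val l t = 0).
    rewrite big1// => u _; rewrite /vertex_fun; case: asboolP => [<-|_]; last by rewrite mul0r.
    by rewrite lt0 mulr0.
  rewrite (bigD1_seq (t : {classic T})) /=; last exact/filter_uniq/undup_uniq.
    rewrite {1}/vertex_fun asboolT// mul1r big1 ?addr0// => u /eqP ut.
    by rewrite /vertex_fun asboolF ?mul0r// => e; apply: ut.
  by rewrite mem_filter tN mem_undup FP.
rewrite [X in X + _](@big1_seq _ _ _ {classic T}) ?add0r => [|u]; last first.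
  rewrite mem_filter => /andP[_ /andP[uN _]]; rewrite /vertex_fun asboolF ?mul0r// => e.
  by move: uN; rewrite -e ltnNge Nt.
have [[x xB tx]|nx] := pselect (exists2 x : {classic X}, x \in undup B & t = node x (level t)).
  rewrite (bigD1_seq x)//=; last exact: undup_uniq.
  rewrite (@big1_seq _ _ _ {classic X}) ?addr0 => [|y /andP[/eqP yx yB]]; last first.
    rewrite /limb_fun; case: asboolP; last by rewrite andbF mul0r.
    by rewrite {1}tx => /esym e; case: (Nsep y yB x xB yx _ Nt).
  have along k : tree_val l (node x (N + k)) =
      @GRing.mul R (chain N k) (tree_val l (node x N)).
    elim: k => [|k IH]; first by rewrite addn0 [RHS]mul1r.
    by rewrite addnS (Nl' x xB) ?leq_addr// IH /= mulrA.
  by rewrite tx limb_fun_node Nt -along subnKC.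
rewrite (@big1_seq _ _ _ {classic X}) => [|x xB]; last first.
  rewrite /limb_fun; case: asboolP; last by rewrite andbF mul0r.
  by move=> e; case: nx; exists x.
by apply: contrapT => /(Nl t Nt).
Qed.

(** The map [branch_sum] realizes the choice of a set [S] of branches: modulo the
    span of the vertices, the tree module is a direct sum of copies of the
    colimit, one for each branch, and [branch_sum] is the inclusion into [germ]
    on the copies in [S] and zero on the other ones. *)
Section BranchSum.
Variable S : X -> Prop.

Definition branch_germ x (l : tree_module) : germ :=
  if `[< S x >] then germ_of (fun n => tree_val l (node x n)) else 0.

Fact branch_germ_linear x : linear (branch_germ x).
Proof.
move=> c l l'; rewrite /branch_germ; case: asboolP => _.
  by rewrite -linearP.
by rewrite scaler0 addr0.
Qed.
HB.instance Definition _ x :=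
  GRing.isLinear.Build _ tree_module germ *:%R (branch_germ x) (branch_germ_linear x).

Lemma branch_germ_finsupp l : finsupp (branch_germ^~ l).
Proof.
have /asboolP[_ [B [N NB]] _] := submod_valP (clS := tree_closed) l.
exists B => x xl; apply: contrapT => xB; apply: xl.
rewrite /branch_germ; case: asboolP => // _; apply/germ_eq0.
have [M MP] : eventually (fun n => forall y : {classic X}, y \in B -> node x n <> node y n).
  apply: eventually_all => y yB.
  have [M MP] : eventually (fun n => node x n <> node y n).
    by apply: branches_separate => e; apply: xB; rewrite e.
  by exists M.
exists (maxn M N) => n; rewrite geq_max => /andP[Mn Nn]; apply: contrapT => ln.
have [|y yB] := NB N (leqnn _) (node x n) _ ln; rewrite level_node//.
exact: (MP n Mn y yB).
Qed.

Fact branch_sum_linear : linear (fun l => fsum (branch_germ^~ l)).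
Proof.
move=> c l l'.
have -> : branch_germ^~ (c *: l + l') = fun x => c *: branch_germ x l + branch_germ x l'.
  by apply: funext => x; exact: linearP.
rewrite fsumD; last exact: branch_germ_finsupp; last first.
  have [B bl] := branch_germ_finsupp l; exists B => x.
  have [->|/bl//] := pselect (branch_germ x l = 0).
  by rewrite scaler0.
by rewrite (fsum_morph (GRing.scale c))//; exact: branch_germ_finsupp.
Qed.
Definition branch_sum : {linear tree_module -> germ} :=
  HB.pack (fun l => fsum (branch_germ^~ l))
    (GRing.isLinear.Build _ tree_module germ *:%R _ branch_sum_linear).

Lemma branch_sum_limb x n : branch_sum (limb x n) = if `[< S x >] then chain_germ n else 0.
Proof.
rewrite /= (@fsum_eq1 _ _ _ x) => [|y yx]; rewrite /branch_germ; case: asboolP => // _.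
  by congr germ_of; apply: functional_extensionality_dep => m; exact: limb_fun_node.
exact/germ_eq0/limb_fun_other.
Qed.

End BranchSum.
End TreeModule.

(** * From precovers to the chain condition *)

Section ChainStabilizes.
Variables (R : pzRingType) (a : nat -> R).

Definition chain_stabilizes : Prop :=
  exists n, forall k, exists r, chain a 0 n = r * chain a 0 k.

(** Let [q] be the family of the classes of [1] in [R / R c_k], where
    [c_k = a_(k-1) ... a_0].  As [s_0 = s_k c_k], the element [s_0 (x) q] vanishes
    in each [B (x) R / R c_k], hence vanishes.  Applying [f], the sequence
    [c_n q] is eventually zero, and [c_n q = 0] says that [c_n] is in [R c_k] for
    all [k]. *)
Lemma mittag_leffler_chain (B : rmodType R) (f : {linear B -> germ R}) (s : nat -> B) :
  flat_mittag_leffler B ->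
  (forall n, s n = (a n : R^c) *: s n.+1) -> f (s 0%N) = chain_germ a 0 ->
  chain_stabilizes.
Proof.
move=> [_ MLB] sS fs0.
pose I k : {pred R^o} := fun x => `[< exists r, x = r * chain a 0 k >].
have clI k : submod_closed (I k).
  split=> [|c x y /asboolP[r ->] /asboolP[r' ->]]; apply/asboolP.
    by exists 0; rewrite mul0r.
  by exists (c * r + r'); rewrite -[c *: _]/(c * _) mulrDl mulrA.
pose q : dprod (fun k => quotmod (clI k)) := fun k => quotmod_pi (clI k) 1.
have s0E k : s 0%N = (chain a 0 k : R^c) *: s k.
  elim: k => [|k IH]; first by rewrite scale1r.
  by rewrite IH {1}sS scalerA.
have tq0 : tens (s 0%N) q = 0.
  apply: MLB; rewrite tensor_prod_tens (zmod_morphism0 (@tensor_prod_additive _ _ _ _)).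
  apply: functional_extensionality_dep => k; rewrite /q.
  rewrite (s0E k) tensZ -linearZ /= (_ : quotmod_pi _ _ = 0) ?tens0r//.
  by apply/quotmod_pi_eq0/asboolP; exists 1; rewrite mul1r -[LHS]/(_ * 1) mulr1.
(* Elements of [germ R (x) prod_k R / R c_k] are evaluated as sequences in the
   product, up to eventually zero sequences. *)
pose ev0 : {pred dprod (fun _ : nat => dprod (fun k => quotmod (clI k)))} :=
  fun u => `[< eventually (fun n => u n = 0) >].
have clev0 : zmod_closed ev0.
  split=> [|u v /asboolP uP /asboolP vP]; apply/asboolP; first by exists 0%N.
  have [N NP] := eventually_and uP vP; exists N => n /NP[un vn].
  by rewrite -[LHS]/(u n - v n) un vn subr0.
have [G [p p0]] := quotient_additive clev0.
have rep w : {u | germ_of u = w :> germ R} by exact/cid/quotmod_surj.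
have repK w : germ_of (sval (rep w)) = w by case: (rep w).
pose b (m : B) (v : dprod (fun k => quotmod (clI k))) : G :=
  p (fun n => (sval (rep (f m)) n : R) *: v).
have p_eq u v : eventually (fun n => u n = v n) -> p u = p v.
  move=> [N NP]; apply/eqP; rewrite -subr_eq0 -raddfB; apply/eqP/p0/asboolP.
  by exists N => n /NP e; rewrite -[LHS]/(u n - v n) e subrr.
have germ_eq (u v : dprod (fun=> R%:mod)) :
    germ_of u = germ_of v :> germ R -> eventually (fun n => u n = v n).
  move=> /eqP; rewrite -subr_eq0 -raddfB => /eqP/germ_eq0[N NP].
  by exists N => n /NP/eqP; rewrite subr_eq0 => /eqP.
have repE m (u : dprod (fun=> R%:mod)) :
    f m = germ_of u -> eventually (fun n => sval (rep (f m)) n = u n).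
  by move=> fm; apply: germ_eq; rewrite repK.
have bal : balanced b.
  split=> [m m' v|m v v'|m r v]; rewrite /b.
  - rewrite -raddfD; apply: p_eq.
    have [|N NP] := repE (m + m') (sval (rep (f m)) + sval (rep (f m'))).
      by rewrite raddfD [RHS]raddfD /= !repK.
    by exists N => n /NP->; exact: scalerDl.
  - rewrite -raddfD; congr (p _); apply: funext => n; exact: scalerDr.
  - apply: p_eq; have [|N NP] := repE ((r : R^c) *: m) ((r : R^c) *: sval (rep (f m))).
      by rewrite linearZ [RHS]linearZ /= repK.
    by exists N => n /NP->; rewrite scalerA.
have : tensor_lift b (tens (s 0%N) q) = 0.
  by rewrite tq0 (zmod_morphism0 (tensor_lift_additive bal)).
rewrite (tensor_lift_tens bal) => /p0/asboolP qev.
have [N NP] := eventually_and qev (repE _ _ fs0).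
have [/= q0] := NP N (leqnn _); rewrite subn0 => rN; exists N => k.
have : (chain a 0 N : R) *: q k = 0 by rewrite -rN -[LHS]/((_ *: q) k) q0.
rewrite -linearZ => /quotmod_pi_eq0/asboolP[r e]; exists r.
by rewrite -e -[RHS]/(_ * 1) mulr1.
Qed.
End ChainStabilizes.

Section BranchTree.
Variable B : Type.

(** A vertex of height [n]; at each height below [n] it records a function from
    the vertices of that height to [B], so that a [branch] amounts to a function
    from all vertices to [B]. *)
Fixpoint partial_branch (n : nat) : Type :=
  if n is n'.+1 then (partial_branch n' * (partial_branch n' -> B))%type else unit.

Definition branch : Type := forall n, partial_branch n -> B.

Fixpoint truncation (x : branch) (n : nat) : partial_branch n :=
  match n return partial_branch n with
  | 0 => tt
  | n'.+1 => (truncation x n', x n')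
  end.

Definition branch_node (x : branch) n : {n & partial_branch n} := existT _ n (truncation x n).

Lemma truncation_inj (x y : branch) m : truncation x m = truncation y m ->
  forall n, (n < m)%N -> x n = y n.
Proof.
elim: m => [//|m IH] [/IH xy xym] n; rewrite ltnS leq_eqVlt.
by case/orP=> [/eqP->//|/xy].
Qed.

Lemma branch_nodes_separate (x y : branch) : x <> y ->
  eventually (fun n => branch_node x n <> branch_node y n).
Proof.
move=> xy; have [n xyn] : exists n, x n <> y n.
  apply: contrapT => H; apply: xy; apply: functional_extensionality_dep => n.
  by apply: contrapT => xyn; apply: H; exists n.
exists n.+1 => m nm e; apply: xyn.
have {e} := @Eqdep_dec.inj_pair2_eq_dec _ (fun i j : nat => eq_comparable i j) _ _ _ _ e.
by move=> /truncation_inj; apply.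
Qed.
End BranchTree.

(** A lift [h] of [branch_sum S] restricts to a map from vertices to [B], which is
    itself a branch [x]; the definition of [S] diagonalizes over this
    coincidence. *)
Lemma precovering_chain_stabilizes (R : pzRingType) (a : nat -> R) :
  precovering (@flat_mittag_leffler R) -> chain_stabilizes a.
Proof.
move=> prec; have [B [f [FMB liftB]]] := prec (germ R).
pose S (x : branch B) := exists z : nat -> B,
  (forall n, f (z n) = 0) /\
  forall n, z n - (a n : R^c) *: z n.+1 = x n (truncation x n).
have level_node (x : branch B) n : projT1 (branch_node x n) = n by [].
pose L := tree_module a (@projT1 _ _) (@branch_node B).
have FML : flat_mittag_leffler L.
  apply/locally_projective_flat_mittag_leffler/tree_locally_projective => //.
  exact: branch_nodes_separate.
have [h hP] := liftB _ (branch_sum a level_node (@branch_nodes_separate B) S) FML.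
pose x : branch B := fun n t => h (vertex a level_node (existT _ n t)).
pose z n := h (limb a level_node (@branch_nodes_separate B) x n).
have zS n : z n - (a n : R^c) *: z n.+1 = x n (truncation x n).
  have -> : z n = x n (truncation x n) + (a n : R^c) *: z n.+1.
    by rewrite /z limb_step raddfD /= linearZ.
  exact: addrK.
have fz n : f (z n) = if `[< S x >] then chain_germ a n else 0.
  rewrite -(branch_sum_limb a level_node (@branch_nodes_separate B)).
  exact/esym/hP.
have [Sx|nSx] := pselect (S x); last first.
  by case: (nSx); exists z; split=> // n; rewrite fz; case: asboolP.
have [w [fw wS]] := Sx.
(* [z] and [w] extend the same map on vertices along [x], so their difference is
   compatible with the direct system. *)
apply: (@mittag_leffler_chain _ _ _ f (fun n => z n - w n) FMB) => [n|].
  have : z n - (a n : R^c) *: z n.+1 = w n - (a n : R^c) *: w n.+1 by rewrite zS wS.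
  move=> /eqP; rewrite subr_eq -addrA => /eqP->.
  by rewrite scalerBr addrAC subrr add0r addrC.
by rewrite raddfB /= fw subr0 fz asboolT.
Qed.

(** * The radical and local idempotents *)

Section Radical.
Variable R : pzRingType.
Implicit Types a b e f g r s t x : R.

(** The Jacobson radical. *)
Definition radical a : Prop := forall r, exists u, u * (1 - r * a) = 1.

Lemma radicalMl s a : radical a -> radical (s * a).
Proof. by move=> Ja r; have [u uP] := Ja (r * s); exists u; rewrite mulrA. Qed.

(** If [u (1 - y x) = 1] then [(1 + x u y) (1 - x y) = 1]. *)
Lemma radicalMr s a : radical a -> radical (a * s).
Proof.
move=> Ja r; have [u uP] := Ja (s * r); exists (1 + r * a * u * s).
have e : s * (1 - r * (a * s)) = (1 - s * r * a) * s.
  by rewrite mulrBr mulrBl mulr1 mul1r !mulrA.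
rewrite mulrDl mul1r -[r * a * u * s * _]mulrA e [r * a * u * (_ * s)]mulrA
  -[r * a * u * _]mulrA uP.
by rewrite mulr1 !mulrA subrK.
Qed.

Lemma radicalD a b : radical a -> radical b -> radical (a + b).
Proof.
move=> Ja Jb r; have [u uP] := Ja r; have [v vP] := Jb (u * r).
exists (v * u); rewrite -mulrA [r * _]mulrDr opprD addrA [u * _]mulrBr uP.
by rewrite [u * _]mulrA vP.
Qed.

Lemma radical0 : radical 0.
Proof. by move=> r; exists 1; rewrite mulr0 subr0 mulr1. Qed.

Lemma radicalN a : radical a -> radical (- a).
Proof. by rewrite -mulN1r; exact: radicalMl. Qed.

Lemma radical_cancel a t x : radical a -> x = t * (a * x) -> x = 0.
Proof.
move=> Ja xE; have [u uP] := Ja t.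
by rewrite -[x]mul1r -uP -mulrA mulrBl mul1r -mulrA -xE subrr mulr0.
Qed.

Lemma radical_idem e : e * e = e -> radical e -> e = 0.
Proof. by move=> ee Je; apply: (@radical_cancel e 1) => //; rewrite ee mul1r. Qed.

Lemma radical_semiprime a : (forall s, radical (a * s * a)) -> radical a.
Proof.
move=> Ja r; have [u uP] := radicalMl r (Ja r) 1; exists (u * (1 + r * a)).
rewrite -mulrA (_ : (1 + r * a) * (1 - r * a) = 1 - 1 * (r * (a * r * a)))//.
by rewrite mulrDl mul1r [r * a * _]mulrBr mulr1 addrA subrK mul1r !mulrA.
Qed.

(** [R b] is minimal among the left ideals that are not inside the radical. *)
Definition left_minimal b : Prop :=
  ~ radical b /\ forall r, ~ radical (r * b) -> exists t, b = t * (r * b).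

Lemma left_minimalMl s b : left_minimal b -> ~ radical (s * b) -> left_minimal (s * b).
Proof.
move=> [_ bmin] Jsb; split=> // r; rewrite mulrA => /bmin[t bE].
by exists (s * t); rewrite -[RHS]mulrA -bE.
Qed.

(** Equivalently, [e R] has a unique maximal submodule, namely [e J]. *)
Definition local_idempotent e : Prop :=
  [/\ e * e = e, ~ radical e & forall x, ~ radical (e * x) -> exists y, e * x * y = e].

(** For [x] in [e R] outside the radical, semiprimeness gives [z = x s e] outside
    the radical.  By minimality every element of [e R e] outside the radical has
    a left inverse in the ring [e R e]; applied to [z], and then to its left
    inverse [e t e], this makes [z] invertible there. *)
Lemma left_minimal_local e : e * e = e -> left_minimal e -> local_idempotent e.
Proof.
move=> ee [Je emin]; split=> // x Jx.
have [s Js] : exists s, ~ radical (e * x * s * (e * x)).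
  apply: contrapT => H; apply/Jx/radical_semiprime => s.
  by apply: contrapT => Js; apply: H; exists s.
pose z := e * x * s * e.
have Jz : ~ radical z by move=> /(radicalMr x); rewrite /z -[_ * e * x]mulrA.
have [t et] := emin _ Jz; rewrite -/z in et.
have ez : e * z = z by rewrite /z !mulrA ee.
have etz : e * t * e * z = e by rewrite -mulrA ez -mulrA -et ee.
have Jt : ~ radical (e * t * e) by move=> /(radicalMr z); rewrite etz.
have [t2 et2] := emin _ Jt.
have zt2 : z = t2 * e.
  rewrite -ez {1}et2; rewrite -mulrA -[_ * e * z]/(e * t * e * z) etz //.
exists (s * e * (e * t * e)).
have -> : e * x * (s * e * (e * t * e)) = z * (e * t * e) by rewrite /z !mulrA.
rewrite zt2 -mulrA (_ : e * (e * t * e) = e * t * e) -?et2//.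
by rewrite !mulrA ee.
Qed.
End Radical.

Section ChainCondition.
Variable R : pzRingType.
Hypothesis dcc : forall a : nat -> R, chain_stabilizes a.
Implicit Types a b e f g r s t x : R.

(** Otherwise dependent choice gives [y_(n+1) = r_n y_n] in [C] with [y_n] not in
    [R y_(n+1)], and the chain of the [r_n] is not stationary. *)
Lemma left_ideal_minimal (C : R -> Prop) x0 : C x0 ->
  exists x, C x /\ forall r, C (r * x) -> exists t, x = t * (r * x).
Proof.
move=> Cx0; apply: contrapT => H.
have next x : {r | C x -> C (r * x) /\ forall t, x <> t * (r * x)}.
  apply: cid; apply: contrapT => nr; have [Cx|nCx] := pselect (C x); last first.
    by apply: nr; exists 0.
  apply: H; exists x; split=> // r Cr; apply: contrapT => nt; apply: nr; exists r => _.
  by split=> // t xt; apply: nt; exists t.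
pose y := fix y n := if n is n'.+1 then sval (next (y n')) * y n' else x0.
have Cy n : C (y n).
  by elim: n => [|n IH] //=; case: (next _) => /= r /(_ IH)[].
have [n /(_ n.+1)[r]] := dcc (fun n => sval (next (y n))).
set c := chain _ 0 => cE.
have yE k : y k = c k * x0.
  elim: k => [|k IH]; first by rewrite mul1r.
  have -> : c k.+1 = sval (next (y k)) * c k by [].
  by rewrite -mulrA -IH.
have /= := svalP (next (y n)) (Cy n).
move=> [_ /(_ r)]; apply.
by rewrite -[sval _ * y n]/(y n.+1) !yE cE mulrA.
Qed.

(** Among the lifts [h] of [e] in [R e], take one whose defect [n = h - h h]
    generates a minimal left ideal among those obtained in this way.  The usual improvement
    [h' = 3 h^2 - 2 h^3 = h - (1 - 2 h) n] has its defect in [R n n], so that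
    [n] is in [R n n] and vanishes, being in the radical. *)
Lemma lift_idempotent e : left_minimal e -> radical (e * e - e) ->
  exists h r, [/\ h = r * e, h * h = h & ~ radical h].
Proof.
move=> [Je emin] Jee.
pose C n := exists h r, [/\ n = h - h * h, h = r * e, ~ radical h & radical n].
have [|n [[h [r [nE hE Jh Jn]]] nmin]] := @left_ideal_minimal C (e - e * e).
  by exists e, 1; rewrite mul1r -opprB; split=> //; exact: radicalN.
have [w wE] : exists w, w = 1 - h - h by exists (1 - h - h).
pose h' := h - w * n.
have nh : n * h = h * n by rewrite nE mulrBl mulrBr mulrA.
have nE' : h * (1 - h) = n by rewrite mulrBr mulr1.
have nw : n * w = w * n by rewrite wE !mulrBr !mulrBl mulr1 mul1r nh.
have hw : h * w = w * h by rewrite wE !mulrBr !mulrBl mulr1 mul1r.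
have key : h' - h' * h' = (4%:R - w * w) * (n * n).
  pose m := w * n.
  have hm : h * m = m * h by rewrite /m mulrA hw -!mulrA nh.
  have mm : m * m = w * w * (n * n) by rewrite /m -mulrA [n * (w * n)]mulrA nw !mulrA.
  have hh : h * h = h - n by rewrite nE opprB addrC subrK.
  have mE : m = n - (h * n + h * n).
    by rewrite /m wE !mulrBl mul1r opprD addrA.
  have hmE : h * m = n * n + n * n - h * n.
    rewrite mE mulrBr mulrDr mulrA hh mulrBl.
    set p := h * n; set q := n * n.
    by rewrite opprD !opprB [q - p + _]addrACA addrCA [p + _]addrA subrr add0r.
  rewrite /h' -/m [RHS]mulrBl -mm mulr_natl.
  rewrite [_ * (h - m)]mulrBl !mulrBr -hm hmE hh.
  set p := h * n; set q := n * n; set X := q + q - p; set d := h - n.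
  have pX : p + X = q + q by rewrite addrC subrK.
  have -> : h - m = (p + p) + d by rewrite mE opprB addrCA.
  clearbody d X.
  rewrite !opprB [X - _ + _]addrC addrA [p + p + d + _]addrACA [d - d]subrr addr0.
  rewrite addrA; congr (_ - _).
  by rewrite -[p + p + X + X]addrA addrACA pX !mulrS mulr0n addr0 !addrA.
have [t nt] : exists t, n = t * ((4%:R - w * w) * n * n).
  apply: nmin; rewrite -mulrA -key; exists h', ((1 - w * (1 - h)) * r); split=> //.
  - rewrite -mulrA -hE /h' mulrBl mul1r -mulrA; congr (_ - _ * _).
    by rewrite nE mulrBl mul1r.
  - move=> Jh'; apply: Jh; rewrite -[h](subrK (w * n)); apply: radicalD => //.
    exact: radicalMl.
  - by rewrite key mulrA; exact: radicalMl.
have n0 : n = 0.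
  by apply: (radical_cancel (t := t * (4%:R - w * w)) Jn); rewrite {1}nt !mulrA.
by exists h, r; split=> //; apply/esym/eqP; rewrite -subr_eq0 -nE n0.
Qed.

(** If [R b0] is minimal outside the radical in [R f], some [b] in [R b0] has
    [b b] outside the radical, and [b = u b b] makes [e = u b] idempotent modulo
    the radical.  A lift [h] of [e] in [R f] is corrected to [f h], which is fixed
    by [f] on both sides. *)
Lemma local_idempotent_exists f : f * f = f -> f <> 0 ->
  exists g, [/\ local_idempotent g, g * f = g & f * g = g].
Proof.
move=> ff f0.
have Jf : ~ radical f by move=> /(radical_idem ff).
have [|b0 [[Jb0 b0f] b0min]] := @left_ideal_minimal (fun x => ~ radical x /\ x * f = x) f.
  by split.
have lb0 : left_minimal b0.
  by split=> // r Jr; apply: b0min; split=> //; rewrite -mulrA b0f.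
have [s Js] : exists s, ~ radical (b0 * s * b0).
  apply: contrapT => H; apply/Jb0/radical_semiprime => s.
  by apply: contrapT => Js; apply: H; exists s.
pose b := s * b0.
have Jb : ~ radical b by move=> /(radicalMl b0); rewrite mulrA.
have lb : left_minimal b := left_minimalMl lb0 Jb.
have [t0 b0E] := lb0.2 _ Jb.
have Jbb : ~ radical (b * b).
  by move=> /(radicalMl t0); rewrite mulrA -[t0 * b]b0E mulrA.
have [u bE] := lb.2 _ Jbb.
pose e := u * b.
have eb : e * b = b by rewrite /e -mulrA.
have Je : ~ radical e by move=> /(radicalMr b); rewrite eb.
have le : left_minimal e := left_minimalMl lb Je.
have Jee : radical (e * e - e).
  have eE : e * e - e = (e * u - u) * b by rewrite mulrBl -mulrA.
  have nb : (e * e - e) * b = 0 by rewrite mulrBl -mulrA !eb subrr.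
  apply: contrapT; rewrite eE => /(lb.2 _)[t bt]; apply: Jbb.
  rewrite {1}bt -eE -mulrA nb mulr0; exact: radical0.
have [h [r [hE hh Jh]]] := lift_idempotent le Jee.
have hf : h * f = h by rewrite hE /e /b -!mulrA b0f.
have lh : left_minimal h by rewrite hE; apply: left_minimalMl => //; rewrite -hE.
have Jfh : ~ radical (f * h).
  by move=> /(radicalMl h); rewrite mulrA hf hh.
exists (f * h); split.
- apply: left_minimal_local; last exact: left_minimalMl.
  by rewrite mulrA -[f * h * f]mulrA hf -mulrA hh.
- by rewrite -mulrA hf.
- by rewrite mulrA ff.
Qed.

(** Splitting off local idempotents from [1] stops: the remaining idempotents
    [f] satisfy [f' = (1 - g) f], so their left ideals strictly
    decrease. *)
Lemma unit_sum_local : exists s : seq R,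
  (forall g, g \in s -> local_idempotent g) /\ 1 = \sum_(g <- s) g.
Proof.
pose C f := f * f = f /\ exists s : seq R,
  (forall g, g \in s -> local_idempotent g) /\ 1 = f + \sum_(g <- s) g.
have [|f [[ff [s [sP sE]]] fmin]] := @left_ideal_minimal C 1.
  by split; [exact: mulr1 | exists [::]; rewrite big_nil addr0].
have [f0|f0] := pselect (f = 0); first by exists s; rewrite {1}sE f0 add0r.
have [g [lg gf fg]] := local_idempotent_exists ff f0.
have [gg Jg _] := lg.
have [|t ft] := fmin (1 - g).
  rewrite mulrBl mul1r gf; split; first by rewrite mulrBl !mulrBr ff fg gf gg subrr subr0.
  exists (g :: s); split=> [x|]; last by rewrite big_cons addrA subrK.
  by rewrite inE => /orP[/eqP->//|/sP].
case: Jg; rewrite -fg; rewrite mulrBl mul1r gf in ft.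
by rewrite ft -mulrA mulrBl fg gg subrr mulr0; exact: radical0.
Qed.

(** Nakayama for the radical [J]: if [S + M J = M] then [S = M].  If not, choose
    [r] with [R r] minimal such that [m r] is outside [S] for some [m].  The
    elements [y] with [y r] in [S] form a group that contains [S], and it
    contains [y a] for [a] in [J] since otherwise minimality gives [r] in
    [R a r] and [r = 0].  Hence it is all of [M]. *)
Lemma radical_superfluous (M : rmodType R) (S : {pred M}) : submod_closed S ->
  (forall A : {pred M}, zmod_closed A -> {subset S <= A} ->
     (forall m a, radical a -> (a : R^c) *: m \in A) -> forall x : M, x \in A) ->
  forall x : M, x \in S.
Proof.
move=> clS H x; apply: contrapT => xS.
pose C r := exists m : M, (r : R^c) *: m \notin S.
have [|r [[m mr] rmin]] := @left_ideal_minimal C 1.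
  by exists x; rewrite scale1r; exact/negP.
case: (clS) => S0 SD.
have SZ (c : R^c) (y : M) : y \in S -> c *: y \in S.
  by move=> yS; rewrite -[_ *: _]addr0; exact: SD.
have SB (u v : M) : u \in S -> v \in S -> u - v \in S.
  by move=> uS vS; rewrite addrC -scaleN1r; exact: SD.
move/negP: mr; apply; apply: (H (fun y => (r : R^c) *: y \in S)) => [|y yS|y a Ja].
- split=> [|u v uA vA]; rewrite -!topredE /=; first by rewrite scaler0.
  by rewrite scalerBr; exact: SB.
- exact: SZ.
rewrite -!topredE /= scalerA; apply/negPn/negP => Cr.
have [|t rt] := rmin a; first by exists y.
by case/negP: Cr; rewrite -[X in X *: y]/(a * r) (radical_cancel Ja rt) mulr0 scale0r.
Qed.
End ChainCondition.

(** * Projective covers from the chain condition *)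

Lemma rscalerA (R : pzRingType) (M : rmodType R) (a b : R) (m : M) :
  (b : R^c) *: ((a : R^c) *: m) = ((a * b : R) : R^c) *: m.
Proof. exact: scalerA. Qed.

Section CoverOfModule.
Variables (R : pzRingType) (M : rmodType R).
Hypothesis dcc : forall a : nat -> R, chain_stabilizes a.

(** This subgroup is [M J], encoded without finite sums. *)
Definition in_radical (x : M) : Prop := forall A : {pred M}, zmod_closed A ->
  (forall m (a : R), radical a -> (a : R^c) *: m \in A) -> x \in A.

Lemma in_radical0 : in_radical 0.
Proof. by move=> A []. Qed.

Lemma in_radicalB x y : in_radical x -> in_radical y -> in_radical (x - y).
Proof. by move=> Jx Jy A clA JA; case: (clA) => _; apply; [exact: Jx | exact: Jy]. Qed.

Lemma in_radicalZ (r : R^c) x : in_radical x -> in_radical (r *: x).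
Proof.
move=> Jx A [A0 AB] JA; apply: (Jx (fun y => r *: y \in A)) => [|m a Ja].
  split=> [|u v]; rewrite -!topredE /=; first by rewrite scaler0.
  by rewrite scalerBr; exact: AB.
rewrite -topredE /= rscalerA; apply: JA; exact: radicalMr.
Qed.

Lemma in_radical_gen m (a : R) : radical a -> in_radical ((a : R^c) *: m).
Proof. by move=> Ja A _; apply. Qed.

Lemma fsum_closed (I : Type) (G : zmodType) (A : {pred G}) (f : I -> G) :
  zmod_closed A -> finsupp f -> (forall i, f i \in A) -> fsum f \in A.
Proof.
move=> [A0 AB] /finsuppP[s [us sP]] fA; rewrite (fsumE us sP).
apply: (big_ind (fun x => x \in A)) => // x y xA yA.
by rewrite -[y]opprK -[- y]sub0r; apply: (AB) => //; exact: AB.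
Qed.

Definition local_pair : Type :=
  {w : M * R | local_idempotent w.2 /\ (w.2 : R^c) *: w.1 = w.1}.
Definition pair_elt (w : local_pair) : M := (sval w).1.
Definition pair_idem (w : local_pair) : R := (sval w).2.

Lemma pair_local w : local_idempotent (pair_idem w).
Proof. by case: (svalP w). Qed.
Lemma pair_idemK w : pair_idem w * pair_idem w = pair_idem w.
Proof. by case: (pair_local w). Qed.
Lemma pair_fix w : (pair_idem w : R^c) *: pair_elt w = pair_elt w.
Proof. by case: (svalP w). Qed.

Definition combination (phi : local_pair -> R^c) : M :=
  fsum (fun w => phi w *: pair_elt w).

Definition independent (D : set local_pair) : Prop :=
  forall phi : local_pair -> R^c, finsupp phi -> (forall w, phi w <> 0 -> D w) ->
    in_radical (combination phi) -> forall w, radical (pair_idem w * phi w).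

(** Applied to the support of a linear combination, this shows that independence
    passes to unions of chains, as Zorn's lemma requires. *)
Lemma chain_finite (F : set (set local_pair)) (s : seq {classic local_pair}) :
  total_on F subset -> (forall w : {classic local_pair}, w \in s -> (\bigcup_(X in F) X) w) ->
  s = [::] \/ exists2 X, F X & forall w : {classic local_pair}, w \in s -> X w.
Proof.
move=> totF; elim: s => [|v s IH] sF; first by left.
right; have [X FX Xv] := sF v (mem_head _ _).
have [|s0|[Y FY Ys]] := IH; first by move=> w ws; apply: sF; rewrite inE ws orbT.
  by exists X => // w; rewrite s0 inE => /eqP->.
have [XY|YX] := totF X Y FX FY.
  exists Y => // w; rewrite inE => /orP[/eqP->|/Ys//]; exact: XY.
by exists X => // w; rewrite inE => /orP[/eqP->//|/Ys/YX].
Qed.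

Lemma independent_maximal : exists D, independent D /\
  forall D', (D `<` D')%classic -> ~ independent D'.
Proof.
apply: Zorn_bigcup => F FI totF phi fphi phiF Jphi w.
have [s [us sP]] := finsuppP fphi.
pose s' : seq {classic local_pair} := [seq v <- s | phi v != 0].
have s'P (v : {classic local_pair}) : phi v <> 0 -> v \in s'.
  by move=> v0; rewrite mem_filter sP//; apply/andP; split=> //; apply/eqP.
have [|s0|[X FX Xs]] := @chain_finite F s' totF.
- by move=> v; rewrite mem_filter => /andP[/eqP v0 _]; exact: phiF.
- have [->|/s'P] := pselect (phi w = 0); last by rewrite s0.
  by rewrite mulr0; exact: radical0.
- by apply: (FI X FX phi) => // v /s'P; exact: Xs.
Qed.

(** Independence modulo [M J] places the kernel of [P -> M] inside [P J], where
    [P] is the direct sum of the [e_w R], so the kernel is superfluous.  Maximality places each [x g],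
    for [g] a local idempotent, in the image modulo [M J]; these elements
    generate [M], so the map is onto. *)
Lemma chain_condition_projective_cover :
  exists (P : rmodType R) (p : {linear P -> M}), projective_cover p.
Proof.
have [D [indD maxD]] := independent_maximal.
(* Indexing by all pairs, with the idempotent [0] outside [D], avoids sums over a
   subtype. *)
pose e w := if `[< D w >] then pair_idem w else 0.
have ee w : e w * e w = e w.
  by rewrite /e; case: asboolP => _; [exact: pair_idemK | exact: mulr0].
pose p : {linear dsum e -> M} := dsum_ext pair_elt.
have p_gen w : D w -> p (dsum_gen ee w) = pair_elt w.
  by move=> Dw; rewrite /p /= dsum_ext_gen /e asboolT// pair_fix.
have ker_radical f : p f = 0 -> forall w, radical (dsum_coord f w).
  move=> pf0 w; rewrite -dsum_coord_fix /e; case: asboolP => [Dw|_]; last first.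
    by rewrite mul0r; exact: radical0.
  apply: (indD (dsum_coord f)); first exact: dsum_finsupp.
    move=> v fv; apply: contrapT => Dv; apply: fv.
    by rewrite -dsum_coord_fix /e asboolF// mul0r.
  by rewrite -[combination _]/(p f) pf0; exact: in_radical0.
exists (dsum e), p; split; first exact: dsum_projective.
  move=> x; apply/asboolP; move: x.
  apply: (radical_superfluous dcc); first exact: image_closed.
  move=> A clA imA JA x.
  have [A0 AB] := clA.
  have AD u v : u \in A -> v \in A -> u + v \in A.
    by move=> uA vA; rewrite -[v]opprK -[- v]sub0r; apply: (AB) => //; exact: AB.
  have pA y : p y \in A by apply: imA; apply/asboolP; exists y.
  have [s [sP sE]] := unit_sum_local dcc.
  have -> : x = \sum_(g <- s) (g : R^c) *: x.
    by rewrite -scaler_suml -[X in X *: _]sE scale1r.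
  rewrite big_seq; apply: (big_ind (fun y => y \in A)) => // g /sP lg.
  have [gg Jg gP] := lg.
  have fixg : (g : R^c) *: ((g : R^c) *: x) = (g : R^c) *: x.
    by rewrite scalerA -[in RHS]gg.
  pose w : local_pair := exist _ ((g : R^c) *: x, g) (conj lg fixg).
  have [Dw|nDw] := pselect (D w); first by rewrite -[_ *: _]/(pair_elt w) -p_gen//; exact: pA.
  have /maxD nind : D `<` (fun v => D v \/ v = w).
    split; first by move=> v; left.
    by move=> /(_ w (or_intror erefl)).
  have {nind} [phi [fphi phiD Jphi [w' Jw']]] : exists phi : local_pair -> R^c,
      [/\ finsupp phi, forall v, phi v <> 0 -> D v \/ v = w,
          in_radical (combination phi) & exists w', ~ radical (pair_idem w' * phi w')].
    apply: contrapT => H; apply: nind => phi fphi phiD Jphi v.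
    apply: contrapT => Jv; apply: H; exists phi; split=> //; by exists v.
  (* In a dependence relation for [D] enlarged by [w], the coefficient of [w] is
     outside the radical, and can be inverted because [g] is local. *)
  pose rest v := if `[< v = w >] then 0 else phi v.
  pose lead v := if `[< v = w >] then phi v else 0.
  have frest : finsupp rest.
    by case: fphi => t tP; exists t => v; rewrite /rest; case: asboolP => // _ /tP.
  have flead : finsupp lead.
    by case: fphi => t tP; exists t => v; rewrite /lead; case: asboolP => // _ /tP.
  have restD v : rest v <> 0 -> D v.
    by rewrite /rest; case: asboolP => // vw /phiD[].
  have phiE : combination phi = phi w *: pair_elt w + combination rest.
    rewrite -[phi w *: _](_ : combination lead = _); last first.
      rewrite /combination (@fsum_eq1 _ _ _ w) /lead; first by rewrite asboolT.
      by move=> v vw; rewrite asboolF// scale0r.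
    rewrite /combination -fsumD; [|exact: finsupp_scale..]; congr fsum; apply: funext => v.
    by rewrite /rest /lead; case: asboolP; rewrite scale0r ?addr0 ?add0r.
  have leadE : phi w *: pair_elt w = ((g * phi w : R) : R^c) *: pair_elt w.
    by rewrite -{1}[pair_elt w]pair_fix scalerA.
  have Jgw : ~ radical (g * phi w).
    move=> Jgw.
    have Jrest : in_radical (combination rest).
      rewrite (_ : combination rest = combination phi - phi w *: pair_elt w).
        by apply: in_radicalB => //; rewrite leadE; exact: in_radical_gen.
      by rewrite phiE addrC addKr.
    apply: Jw'; have [->//|w'w] := pselect (w' = w).
    have := indD rest frest restD Jrest w'.
    by rewrite /rest asboolF.
  have [y gy] := gP _ Jgw.
  have yE : (y : R^c) *: (phi w *: pair_elt w) = pair_elt w.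
    by rewrite leadE rscalerA gy; exact: (pair_fix w).
  rewrite -[_ *: x]/(pair_elt w) -yE.
  rewrite (_ : phi w *: pair_elt w = combination phi - combination rest); last first.
    by rewrite phiE addrK.
  rewrite scalerBr; apply: (AB); first exact: (in_radicalZ _ Jphi).
  rewrite /combination -[_ *: _]/(GRing.scale (y : R^c) _) fsum_morph;
    last exact: finsupp_scale.
  apply: fsum_closed => //.
    case: frest => t tP; exists t => v vP; apply: tP => v0.
    by apply: vP; rewrite v0 scale0r /= scaler0.
  move=> v; have [v0|/restD/p_gen vE] := pselect (rest v = 0).
    by rewrite v0 scale0r /= scaler0.
  rewrite -vE; have := pA ((y : R^c) *: ((rest v : R^c) *: dsum_gen ee v)).
  by rewrite !linearZ.
(* Each [k] in the kernel is the sum of the multiples of the generators by its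
   coordinates, which are in the radical. *)
move=> S clS SK; apply: (radical_superfluous dcc clS) => A clA SA JA f.
have [A0 AB] := clA.
have [u [k [uS k0 ->]]] := SK f.
rewrite -[k]opprK; apply: (AB); first exact: SA.
rewrite -[- k]sub0r; apply: (AB) => //.
rewrite (dsum_expand ee k); apply: fsum_closed => // [|w].
  exact/finsupp_scale/dsum_finsupp.
exact/JA/ker_radical.
Qed.
End CoverOfModule.

Theorem theorem3p3 (R : pzRingType) :
  precovering (@flat_mittag_leffler R) <-> right_perfect R.
Proof.
split=> [prec M|]; last exact: right_perfect_precovering.
by apply: chain_condition_projective_cover => a; exact: precovering_chain_stabilizes.
Qed.
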